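(* Let $T$ be a complete theory in which every complete 1-type over every small set is stationarily ordered. Then $T$ is dp-minimal, and Lascar strong types coincide with types over arbitrary small sets (Lstp = tp).
   Context: Work in a monster model $\mathfrak C$. A type $p\in S_1(A)$ is stationarily ordered if there is an $A$-definable linear order $(D,<)$ with $p(\mathfrak C)\subseteq D$ such that for every $\mathfrak C$-definable set $X$, one of $X,\mathfrak C\setminus X$ contains an initial segment of $(p(\mathfrak C),<)$, and one of them contains a final segment. *)

(* Defs.v *)
From Stdlib Require Import List.
Import ListNotations.
Set Implicit Arguments.

(* A first-order (one-sorted) language: function and relation symbols.
   Symbols are interpreted on lists of arguments (arity is implicit). *)
Record language := Language { func : Type; rel : Type }.

Record structure (L : language) := Structure {
  carrier :> Type;
  carrier_inhabited : inhabited carrier;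
  ifunc : func L -> list carrier -> carrier;
  irel : rel L -> list carrier -> Prop }.

Arguments ifunc {L} s f l.
Arguments irel {L} s r l.

Section Syntax.
Variable L : language.
Variable P : Type.

(* terms with de Bruijn variables and parameters *)
Inductive term : Type :=
| tvar : nat -> term
| tpar : P -> term
| tapp : func L -> list term -> term.

Inductive formula : Type :=
| feq : term -> term -> formula
| frel : rel L -> list term -> formula
| fneg : formula -> formula
| fand : formula -> formula -> formula
| fex : formula -> formula.      (* binds variable 0 *)

Fixpoint tparams_in (A : P -> Prop) (t : term) : Prop :=
  match t with
  | tvar _ => True
  | tpar p => A p
  | tapp _ ts => (fix go l := match l with
                  | nil => True
                  | t :: l => tparams_in A t /\ go l end) ts
  end.

Fixpoint tsparams_in (A : P -> Prop) (ts : list term) : Prop :=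
  match ts with nil => True | t :: l => tparams_in A t /\ tsparams_in A l end.

Fixpoint params_in (A : P -> Prop) (phi : formula) : Prop :=
  match phi with
  | feq t1 t2 => tparams_in A t1 /\ tparams_in A t2
  | frel _ ts => tsparams_in A ts
  | fneg f => params_in A f
  | fand f g => params_in A f /\ params_in A g
  | fex f => params_in A f
  end.

Fixpoint tbound (k : nat) (t : term) : Prop :=
  match t with
  | tvar n => n < k
  | tpar _ => True
  | tapp _ ts => (fix go l := match l with
                  | nil => True
                  | t :: l => tbound k t /\ go l end) ts
  end.

Fixpoint tsbound (k : nat) (ts : list term) : Prop :=
  match ts with nil => True | t :: l => tbound k t /\ tsbound k l end.

Fixpoint fbound (k : nat) (phi : formula) : Prop :=
  match phi with
  | feq t1 t2 => tbound k t1 /\ tbound k t2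
  | frel _ ts => tsbound k ts
  | fneg f => fbound k f
  | fand f g => fbound k f /\ fbound k g
  | fex f => fbound (S k) f
  end.
End Syntax.

Arguments tvar {L P} n.
Arguments tpar {L P} p.

Definition scons {C : Type} (c : C) (e : nat -> C) : nat -> C :=
  fun n => match n with 0 => c | S m => e m end.

Definition env1 {C : Type} (x : C) : nat -> C := fun _ => x.

Section Semantics.
Variable L : language.
Variable M : structure L.

Definition mformula := formula L M.

Fixpoint teval (e : nat -> M) (t : term L M) : M :=
  match t with
  | tvar n => e n
  | tpar p => p
  | tapp f ts => ifunc M f (map (teval e) ts)
  end.

Fixpoint sat (e : nat -> M) (phi : mformula) : Prop :=
  match phi with
  | feq t1 t2 => teval e t1 = teval e t2
  | frel r ts => irel M r (map (teval e) ts)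
  | fneg f => ~ sat e f
  | fand f g => sat e f /\ sat e g
  | fex f => exists c : M, sat (scons c e) f
  end.

Definition parameter_free (phi : mformula) : Prop := params_in (fun _ => False) phi.

Definition automorphism (s : M -> M) : Prop :=
  (exists s' : M -> M, (forall x, s' (s x) = x) /\ (forall y, s (s' y) = y)) /\
  (forall f l, s (ifunc M f l) = ifunc M f (map s l)) /\
  (forall r l, irel M r l <-> irel M r (map s l)).

(* N (a subset of M) is the universe of an elementary substructure of M
   (Tarski--Vaught criterion) *)
Definition elementary_substructure (N : M -> Prop) : Prop :=
  (exists x, N x) /\
  forall phi : mformula, fbound 1 phi -> params_in N phi ->
    (exists x, sat (env1 x) phi) -> exists x, N x /\ sat (env1 x) phi.

Section Card.
Variable K : Type. (* a type of cardinality kappa *)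

Definition injective {X Y} (f : X -> Y) := forall x y, f x = f y -> x = y.

Definition card_lt (X : Type) : Prop :=
  (exists f : X -> K, injective f) /\ ~ (exists g : K -> X, injective g).

Definition small (A : M -> Prop) : Prop := card_lt {x : M | A x}.

Definition saturated : Prop :=
  forall (A : M -> Prop) (Sigma : mformula -> Prop),
    small A ->
    (forall phi, Sigma phi -> fbound 1 phi /\ params_in A phi) ->
    (forall l : list mformula, (forall phi, In phi l -> Sigma phi) ->
        exists x, forall phi, In phi l -> sat (env1 x) phi) ->
    exists x, forall phi, Sigma phi -> sat (env1 x) phi.

Definition strongly_homogeneous : Prop :=
  forall (A : M -> Prop) (f : M -> M),
    small A ->
    (forall (phi : mformula) (e : nat -> M), parameter_free phi ->
        (forall i, A (e i)) -> (sat e phi <-> sat (fun i => f (e i)) phi)) ->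
    exists s, automorphism s /\ forall x, A x -> s x = f x.

(* M is a monster model of its (complete) theory T = Th(M), with
   kappa uncountable and kappa > |L| *)
Definition monster : Prop :=
  card_lt nat /\ card_lt (func L + rel L)%type /\
  saturated /\ strongly_homogeneous.

(* Lascar strong types: Autf(M/A) is the group generated by the
   automorphisms fixing pointwise a small elementary substructure N ⊇ A *)
Definition strong_auto_step (A : M -> Prop) (s : M -> M) : Prop :=
  automorphism s /\ exists N : M -> Prop,
    small N /\ elementary_substructure N /\ (forall x, A x -> N x) /\
    (forall x, N x -> s x = x).

Fixpoint compose_all (l : list (M -> M)) : M -> M :=
  match l with nil => fun x => x | s :: l => fun x => s (compose_all l x) end.

Definition Autf (A : M -> Prop) (s : M -> M) : Prop :=
  exists l : list (M -> M), (forall t, In t l -> strong_auto_step A t) /\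
    forall x, s x = compose_all l x.

(* n-tuples a, b (only coordinates < n matter) *)
Definition same_lstp (A : M -> Prop) (n : nat) (a b : nat -> M) : Prop :=
  exists s, Autf A s /\ forall i, i < n -> s (a i) = b i.
End Card.

Definition same_type (A : M -> Prop) (n : nat) (a b : nat -> M) : Prop :=
  forall phi : mformula, fbound n phi -> params_in A phi ->
    (sat a phi <-> sat b phi).

Definition complete_1type (A : M -> Prop) (p : mformula -> Prop) : Prop :=
  (forall phi, p phi -> fbound 1 phi /\ params_in A phi) /\
  (forall l : list mformula, (forall phi, In phi l -> p phi) ->
      exists x, forall phi, In phi l -> sat (env1 x) phi) /\
  (forall phi, fbound 1 phi -> params_in A phi -> p phi \/ p (fneg phi)).

Definition realizes (p : mformula -> Prop) (x : M) : Prop :=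
  forall phi, p phi -> sat (env1 x) phi.

Definition initial_segment (Q : M -> Prop) (lt : M -> M -> Prop) (S : M -> Prop) :=
  (forall x, S x -> Q x) /\ (exists x, S x) /\
  (forall x y, S x -> Q y -> lt y x -> S y).

Definition final_segment (Q : M -> Prop) (lt : M -> M -> Prop) (S : M -> Prop) :=
  (forall x, S x -> Q x) /\ (exists x, S x) /\
  (forall x y, S x -> Q y -> lt x y -> S y).

Definition subset (X Y : M -> Prop) := forall x, X x -> Y x.

Definition stationarily_ordered (A : M -> Prop) (p : mformula -> Prop) : Prop :=
  exists delta lambda : mformula,
    fbound 1 delta /\ params_in A delta /\
    fbound 2 lambda /\ params_in A lambda /\
    let D := fun x => sat (env1 x) delta in
    let lt := fun x y => sat (scons x (env1 y)) lambda in
    (forall x, D x -> ~ lt x x) /\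
    (forall x y z, D x -> D y -> D z -> lt x y -> lt y z -> lt x z) /\
    (forall x y, D x -> D y -> x <> y -> lt x y \/ lt y x) /\
    subset (realizes p) D /\
    forall chi : mformula, fbound 1 chi ->
      let X := fun x => sat (env1 x) chi in
      let Xc := fun x => ~ sat (env1 x) chi in
      ((exists S, initial_segment (realizes p) lt S /\ subset S X) \/
       (exists S, initial_segment (realizes p) lt S /\ subset S Xc)) /\
      ((exists S, final_segment (realizes p) lt S /\ subset S X) \/
       (exists S, final_segment (realizes p) lt S /\ subset S Xc)).

(* T = Th(M) is dp-minimal: there is no ict-pattern of depth 2 in one
   variable x (x = var 0, remaining variables are the parameter variables) *)
Definition dp_minimal : Prop :=
  ~ exists (phi psi : mformula) (b c : nat -> nat -> M),
      parameter_free phi /\ parameter_free psi /\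
      forall i j, exists a : M,
        sat (scons a (b i)) phi /\ sat (scons a (c j)) psi /\
        (forall k, k <> i -> ~ sat (scons a (b k)) phi) /\
        (forall k, k <> j -> ~ sat (scons a (c k)) psi).
End Semantics.

(* Main.v *)
(* One-types: the two ends of the locus of a stationarily ordered type [p] over
   [A] are global [A]-invariant types.  If [a], [b] realize [p], take models
   [N_a], [N_b] over which [a], [b] realize the left end, and [d] realizing it
   over both: then [a], [d] have the same type over [N_a], and [d], [b] over
   [N_b].  Hence Lstp = tp for elements, and for tuples one coordinate at a time.

   Dp-minimality: being stationarily ordered does not depend on the order, in the
   sense that every definable set is decided near the left end of the locus of [p]
   for any [A]-definable linear order.  From an ict-pattern one extracts an
   indiscernible array [A r s] together with sets [X], [Y] containing exactly the
   entries of row 0 and of column 0, respectively.  An order witnessing that the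
   type of the entries is stationarily ordered makes the array lexicographic, say
   with the row index dominant and increasing.  Then [A r 0] and [A r 1] converge to
   the same type over the entries of column 2, and at its left end [Y] is
   undecided. *)
From Stdlib Require Import List Lia Arith Classical ClassicalEpsilon.
From Stdlib Require Import FunctionalExtensionality.
From Stdlib Require Cantor.
From mathcomp Require boolp classical_sets filter.
Require Import Defs.
Import ListNotations.

Set Implicit Arguments.

(** * Cardinals *)

(** The hypothesis is used twice for the array: over the empty set it yields the parameter-free
    order that arranges the entries, and over column 2 it makes the limit type of columns 0 and 1
    stationarily ordered, but by an order unrelated to the first. Independence of the order bridges
    the two. The delicate case there is an order that becomes small at both ends of the other one;
    conjugacy of all realizations excludes it. Column 2 is a suitable base for two reasons. Shifting
    column 0 to column 1 leaves it fixed, so both columns have the same limit type over it; and it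
    has entries above any given row, so realizations of that limit type lie above the whole array,
    and far entries of columns 0 and 1 approximate points near their left end. Indiscernibility
    comes from iterated ultrafilter limits and needs no Ramsey argument. Small models and unions of
    small sets require cardinal arithmetic below an arbitrary [K]; all of it is reduced to the fact
    that an infinite set absorbs the finite lists over it. *)

Lemma zorn_union (T : Type) (P : (T -> Prop) -> Prop) :
  (forall F : (T -> Prop) -> Prop, (forall X, F X -> P X) ->
     (forall X Y, F X -> F Y -> (forall t, X t -> Y t) \/ (forall t, Y t -> X t)) ->
     P (fun t => exists X, F X /\ X t)) ->
  exists A, P A /\ forall B, P B -> (forall t, A t -> B t) -> forall t, B t -> A t.
Proof.
  intros H. destruct (@classical_sets.Zorn_bigcup T P) as [A [PA max]].
  - intros F FP tot.
    replace (classical_sets.bigcup F (fun X => X))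
      with (fun t => exists X, F X /\ X t).
    + apply H; [exact FP | exact tot].
    + apply boolp.funext. intros t. apply boolp.propext. split.
      * intros [X [FX Xt]]. exists X; assumption.
      * intros [X FX Xt]. exists X; split; assumption.
  - exists A. split; [exact PA |]. intros B PB AB t Bt. apply NNPP. intros nAt.
    apply (max B); [| exact PB]. split; [exact AB |]. intros BA. exact (nAt (BA t Bt)).
Qed.

Lemma cardinals_comparable (X Y : Type) :
  (exists f : X -> Y, injective f) \/ (exists g : Y -> X, injective g).
Proof.
  set (P := fun G : X * Y -> Prop =>
    forall p q, G p -> G q -> fst p = fst q <-> snd p = snd q).
  destruct (@zorn_union (X * Y) P) as [G [PG max]].
  { intros F FP tot p q [U [FU Up]] [V [FV Vq]].
    destruct (tot U V FU FV) as [UV | VU].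
    - apply (FP V FV); auto.
    - apply (FP U FU); auto. }
  assert (ext : forall x y, (forall y', ~ G (x, y')) -> (forall x', ~ G (x', y)) -> False).
  { intros x y nx ny. apply (nx y).
    apply (max (fun p => G p \/ p = (x, y))); [| intros; left; assumption | right; reflexivity].
    intros [x1 y1] [x2 y2] [H1 | H1] [H2 | H2]; cbn.
    - apply (PG _ _ H1 H2).
    - injection H2 as -> ->. split; intros ->; exfalso; [apply (nx y1) | apply (ny x1)]; assumption.
    - injection H1 as -> ->. split; intros <-; exfalso; [apply (nx y2) | apply (ny x2)]; assumption.
    - injection H1 as -> ->. injection H2 as -> ->. tauto. }
  destruct (classic (forall x, exists y, G (x, y))) as [tot | ntot].
  - left. exists (fun x => proj1_sig (constructive_indefinite_description _ (tot x))).
    intros x x'. destruct constructive_indefinite_description as [y Gy].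
    destruct constructive_indefinite_description as [y' Gy']. cbn. intros ->.
    apply (PG _ _ Gy Gy'). reflexivity.
  - right. assert (tot : forall y, exists x, G (x, y)).
    { intros y. apply NNPP. intros ny. apply ntot. intros x. apply NNPP. intros nx.
      apply (ext x y); [intros y' Gy; apply nx | intros x' Gx; apply ny]; eauto. }
    exists (fun y => proj1_sig (constructive_indefinite_description _ (tot y))).
    intros y y'. destruct constructive_indefinite_description as [x Gx].
    destruct constructive_indefinite_description as [x' Gx']. cbn. intros ->.
    apply (PG _ _ Gx Gx'). reflexivity.
Qed.

Lemma injective_list_nat : exists f : list nat -> nat, injective f.
Proof.
  exists (fix f l := match l with nil => 0 | x :: l => S (Cantor.to_nat (x, f l)) end).
  intros l. induction l as [| x l IH]; intros [| y l'] E; try discriminate; [reflexivity |].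
  apply eq_add_S, (f_equal Cantor.of_nat) in E. rewrite !Cantor.cancel_of_to in E.
  injection E as -> E. f_equal. apply IH, E.
Qed.

Lemma injective_map (X Y : Type) (f : X -> Y) : injective f -> injective (map f).
Proof.
  intros Hf l. induction l as [| x l IH]; intros [| y l'] E; try discriminate; [reflexivity |].
  injection E as E1 E2. f_equal; [apply Hf, E1 | apply IH, E2].
Qed.

Lemma injective_on_map (X Y : Type) (P : X -> Prop) (f : X -> Y) :
  (forall x y, P x -> P y -> f x = f y -> x = y) ->
  forall l l', Forall P l -> Forall P l' -> map f l = map f l' -> l = l'.
Proof.
  intros Hf l. induction l as [| x l IH]; intros [| y l'] F F' E; try discriminate; [reflexivity |].
  inversion F; inversion F'; subst. injection E as E1 E2. f_equal; [apply Hf | apply IH]; auto.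
Qed.

(* Zorn's lemma is applied to the graphs [G] of injections from the non-empty
   lists over some [Y] into [Y]; [Y] is recovered from [G] as [dom G].  The
   empty graph is allowed, so that the empty chain has an upper bound. *)
Section ListAbsorption.
Variable X : Type.

Let dom (G : list X * X -> Prop) (x : X) : Prop := exists y, G ([x], y).

Let good (G : list X * X -> Prop) : Prop :=
  (forall l y, G (l, y) -> l <> [] /\ Forall (dom G) l /\ dom G y) /\
  (forall l, l <> [] -> Forall (dom G) l -> exists y, G (l, y)) /\
  (forall l y l' y', G (l, y) -> G (l', y') -> l = l' <-> y = y').

Lemma good_chain (F : (list X * X -> Prop) -> Prop) :
  (forall G, F G -> good G) ->
  (forall G H, F G -> F H -> (forall t, G t -> H t) \/ (forall t, H t -> G t)) ->
  good (fun t => exists G, F G /\ G t).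
Proof.
  intros Fg tot.
  assert (mono : forall G, F G -> forall l, Forall (dom G) l ->
            Forall (dom (fun t => exists G, F G /\ G t)) l).
  { intros G FG l. apply Forall_impl. intros x [y Gy]. exists y, G. auto. }
  split; [| split].
  - intros l y [G [FG Gly]]. destruct (proj1 (Fg G FG) l y Gly) as [ne [Fl [z Gz]]].
    split; [exact ne | split; [exact (mono G FG l Fl) | exists z, G; auto]].
  - intros l ne Fl.
    (* A list has finitely many entries and the chain is totally ordered, so a single member covers
       them all. *)
    assert (one : exists G, F G /\ Forall (dom G) l).
    { clear mono. induction l as [| x l IH]; [congruence |].
      inversion Fl as [| ? ? [y [G [FG Gy]]] Fl']; subst.
      destruct l as [| x' l'].
      - exists G. split; [exact FG | constructor; [exists y; exact Gy | constructor]].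
      - destruct IH as [H [FH Hl]]; [discriminate | exact Fl' |].
        destruct (tot G H FG FH) as [GH | HG].
        + exists H. split; [exact FH |]. constructor; [exists y; auto | exact Hl].
        + exists G. split; [exact FG |]. constructor; [exists y; exact Gy |].
          revert Hl. apply Forall_impl. intros z [w Hw]. exists w. auto. }
    destruct one as [G [FG Gl]]. destruct (proj1 (proj2 (Fg G FG)) l ne Gl) as [y Gy].
    exists y, G. auto.
  - intros l y l' y' [G [FG Gl]] [H [FH Hl]].
    destruct (tot G H FG FH) as [GH | HG].
    + apply (Fg H FH); auto.
    + apply (Fg G FG); auto.
Qed.

Lemma good_of_injection (Y : X -> Prop) (f : list X -> X) :
  (forall l, l <> [] -> Forall Y l -> Y (f l)) ->
  (forall l l', l <> [] -> l' <> [] -> Forall Y l -> Forall Y l' -> f l = f l' -> l = l') ->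
  good (fun t => fst t <> [] /\ Forall Y (fst t) /\ snd t = f (fst t)).
Proof.
  intros fY finj.
  assert (D : forall x, dom (fun t => fst t <> [] /\ Forall Y (fst t) /\ snd t = f (fst t)) x <-> Y x).
  { intros x. unfold dom. cbn. split.
    - intros [y [_ [H _]]]. inversion H; assumption.
    - intros Yx. exists (f [x]). split; [discriminate | split; [auto | reflexivity]]. }
  unfold good. cbn. split; [| split].
  - intros l y [ne [Fl E]]. split; [exact ne | split].
    + revert Fl. apply Forall_impl. intros x. apply D.
    + subst y. apply D, fY; assumption.
  - intros l ne Fl. exists (f l). split; [exact ne | split; [| reflexivity]].
    revert Fl. apply Forall_impl. intros x. apply D.
  - intros l y l' y' [ne [Fl E]] [ne' [Fl' E']]. subst. split; [congruence |].
    apply finj; assumption.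
Qed.

(** A maximal coded subset [Y] must be as large as [X]: if [Y] fitted into its complement, a
    disjoint copy could be adjoined to it. Hence the complement fits into [Y], and lists over [X]
    are translated into lists over [Y]. *)
Lemma injective_list_of_infinite :
  (exists j : nat -> X, injective j) -> exists c : list X -> X, injective c.
Proof.
  intros [j Hj].
  destruct (@zorn_union _ good good_chain) as [G [[Gdom [Gtot Ginj]] max]].
  set (Y := dom G).
  assert (fex : exists f : list X -> X, forall l, l <> [] -> Forall Y l -> G (l, f l)).
  { exists (fun l => epsilon (inhabits (j 0)) (fun y => G (l, y))).
    intros l ne Fl. apply epsilon_spec. apply Gtot; assumption. }
  destruct fex as [f Gf].
  assert (fY : forall l, l <> [] -> Forall Y l -> Y (f l)).
  { intros l ne Fl. apply (Gdom l), Gf; assumption. }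
  assert (finj : forall l l', l <> [] -> l' <> [] -> Forall Y l -> Forall Y l' ->
            f l = f l' -> l = l').
  { intros l l' ne ne' Fl Fl' E. apply (Ginj l (f l) l' (f l')); auto. }
  assert (maxY : forall (Y' : X -> Prop) (f' : list X -> X),
     (forall l, l <> [] -> Forall Y' l -> Y' (f' l)) ->
     (forall l l', l <> [] -> l' <> [] -> Forall Y' l -> Forall Y' l' -> f' l = f' l' -> l = l') ->
     (forall x, Y x -> Y' x) ->
     (forall l, l <> [] -> Forall Y l -> f' l = f l) ->
     forall x, Y' x -> Y x).
  { intros Y' f' f'Y f'inj sub agree x Y'x.
    exists (f' [x]).
    apply (max _ (@good_of_injection Y' f' f'Y f'inj)).
    - intros [l y] Gly. cbn. destruct (Gdom l y Gly) as [ne [Fl _]].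
      split; [exact ne | split].
      + revert Fl. apply Forall_impl. exact sub.
      + rewrite agree by assumption. apply (Ginj l y l (f l)); auto.
    - cbn. split; [discriminate | split; [auto | reflexivity]]. }
  (* If [Y] were empty, the image of [j] with the coding of lists of naturals would be a larger
     coded set. *)
  assert (ne : exists y0, Y y0).
  { apply NNPP. intros no.
    destruct injective_list_nat as [g Hg].
    set (jinv := fun x => epsilon (inhabits 0) (fun n => j n = x)).
    assert (Hjinv : forall n, jinv (j n) = n).
    { intros n. apply Hj. unfold jinv. apply (epsilon_spec (inhabits 0) (fun m => j m = j n)).
      exists n; reflexivity. }
    apply no. exists (j 0).
    apply (maxY (fun x => exists n, x = j n) (fun l => j (g (map jinv l)))).
    - intros l _ _. eauto.
    - intros l l' _ _ Fl Fl' E. apply Hj, Hg in E. revert E.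
      apply injective_on_map with (P := fun x => exists n, x = j n); [| exact Fl | exact Fl'].
      intros x y [n ->] [m ->]. rewrite !Hjinv. congruence.
    - intros x Yx. exfalso. eauto.
    - intros l nel Fl. exfalso. destruct l as [| x l]; [congruence |]. inversion Fl; eauto.
    - eauto. }
  destruct ne as [y0 Yy0].
  (* [y1] and [y2] serve as two distinct tags, telling elements of [Y] from elements outside [Y] in
     [code]. *)
  set (y1 := f [y0]).
  set (y2 := f [y0; y0]).
  assert (Yy1 : Y y1) by (apply fY; [discriminate | auto]).
  assert (Yy2 : Y y2) by (apply fY; [discriminate | auto]).
  assert (y12 : y1 <> y2).
  { intros E. apply finj in E; try discriminate; auto. }
  assert (F2 : forall a b, Y a -> Y b -> Forall Y [a; b]) by auto.
  assert (finj2 : forall a b a' b', Y a -> Y b -> Y a' -> Y b' -> f [a; b] = f [a'; b'] ->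
            a = a' /\ b = b').
  { intros a b a' b' Ha Hb Ha' Hb' E. apply finj in E; try discriminate; auto.
    injection E as -> ->. auto. }
  destruct (cardinals_comparable {x | Y x} {x | ~ Y x}) as [[h Hh] | [k Hk]].
  - exfalso.
    set (h' := fun x => match excluded_middle_informative (Y x) with
                        | left p => proj1_sig (h (exist _ x p)) | right _ => x end).
    assert (h'Y : forall x, Y x -> ~ Y (h' x)).
    { intros x Yx. unfold h'. destruct excluded_middle_informative as [p | np]; [| tauto].
      apply proj2_sig. }
    assert (h'inj : forall x y, Y x -> Y y -> h' x = h' y -> x = y).
    { intros x y Yx Yy. unfold h'.
      destruct excluded_middle_informative as [p | np]; [| tauto].
      destruct excluded_middle_informative as [q | nq]; [| tauto].
      intros E. assert (E' : h (exist _ x p) = h (exist _ y q)).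
      { destruct (h (exist _ x p)), (h (exist _ y q)). cbn in E. subst. f_equal.
        apply proof_irrelevance. }
      apply Hh in E'. congruence. }
    set (Y' := fun x => Y x \/ exists y, Y y /\ x = h' y).
    set (hinv := fun x => epsilon (inhabits y0) (fun y => Y y /\ x = h' y)).
    assert (Hhinv : forall x, Y' x -> ~ Y x -> Y (hinv x) /\ x = h' (hinv x)).
    { intros x [Yx | ex] nYx; [tauto |].
      apply (epsilon_spec (inhabits y0) (fun y => Y y /\ x = h' y)), ex. }
    set (code := fun x => if excluded_middle_informative (Y x) then f [y1; x]
                          else f [y2; hinv x]).
    assert (codeY : forall x, Y' x -> Y (code x)).
    { intros x Y'x. unfold code. destruct excluded_middle_informative as [p | np].
      - apply fY; [discriminate | auto].
      - apply fY; [discriminate |]. apply F2; [exact Yy2 |]. apply Hhinv; assumption. }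
    assert (codeinj : forall x y, Y' x -> Y' y -> code x = code y -> x = y).
    { intros x y Y'x Y'y. unfold code.
      destruct (excluded_middle_informative (Y x)) as [p | np];
      destruct (excluded_middle_informative (Y y)) as [q | nq]; intros E.
      - apply finj2 in E; tauto.
      - destruct (Hhinv y Y'y nq). apply finj2 in E; tauto.
      - destruct (Hhinv x Y'x np). apply finj2 in E; auto. destruct E; congruence.
      - destruct (Hhinv x Y'x np). destruct (Hhinv y Y'y nq).
        apply finj2 in E; auto. destruct E. congruence. }
    assert (codeF : forall l, Forall Y' l -> Forall Y (map code l)).
    { intros l. rewrite Forall_map. apply Forall_impl. exact codeY. }
    assert (mapne : forall l, l <> [] -> map code l <> []).
    { intros [| x l]; cbn; congruence. }
    (* Lists over [Y] keep their code in [Y]; a list with a new entry is first coded in [Y] and then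
       sent to the new copy [h' Y], so the two kinds of codes cannot clash. *)
    set (f' := fun l => if excluded_middle_informative (Forall Y l) then f l
                        else h' (f (map code l))).
    apply (h'Y y0 Yy0). apply (maxY Y' f').
    + intros l ne Fl. unfold f'. destruct excluded_middle_informative as [p | np].
      * left. auto.
      * right. exists (f (map code l)). auto.
    + intros l l' ne ne' Fl Fl'. unfold f'.
      destruct (excluded_middle_informative (Forall Y l)) as [p | np];
      destruct (excluded_middle_informative (Forall Y l')) as [q | nq]; intros E.
      * apply finj; assumption.
      * exfalso. apply (h'Y (f (map code l'))); [auto |]. rewrite <- E. auto.
      * exfalso. apply (h'Y (f (map code l))); [auto |]. rewrite E. auto.
      * apply h'inj in E; auto. apply finj in E; auto.
        revert E. apply injective_on_map with (P := Y'); assumption.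
    + intros x Yx. left. exact Yx.
    + intros l _ Fl. unfold f'. destruct excluded_middle_informative; tauto.
    + right. exists y0. auto.
  - set (code := fun x => match excluded_middle_informative (Y x) with
                          | left p => f [y1; x]
                          | right np => f [y2; proj1_sig (k (exist _ x np))] end).
    assert (codeY : forall x, Y (code x)).
    { intros x. unfold code. destruct excluded_middle_informative as [p | np];
      (apply fY; [discriminate |]); apply F2; auto. apply proj2_sig. }
    assert (codeinj : injective code).
    { intros x y. unfold code.
      destruct (excluded_middle_informative (Y x)) as [p | np];
      destruct (excluded_middle_informative (Y y)) as [q | nq]; intros E;
      apply finj2 in E; auto; try apply proj2_sig; destruct E as [E1 E2]; try congruence.
      assert (E' : k (exist _ x np) = k (exist _ y nq)).
      { destruct (k (exist _ x np)), (k (exist _ y nq)). cbn in E2. subst. f_equal.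
        apply proof_irrelevance. }
      apply Hk in E'. congruence. }
    (* [f] is controlled on non-empty lists only; the extra entry [y0] takes care of the empty
       list. *)
    exists (fun l => f (y0 :: map code l)).
    assert (F : forall l, Forall Y (y0 :: map code l)).
    { intros l. constructor; [exact Yy0 |]. apply Forall_map, Forall_forall. auto. }
    intros l l' E. apply finj in E; try discriminate; auto.
    injection E as E. revert E. apply injective_map, codeinj.
Qed.
End ListAbsorption.

Section Cardinals.
Variable K : Type.

Lemma card_lt_le (X Y : Type) (f : X -> Y) : injective f -> card_lt K Y -> card_lt K X.
Proof.
  intros Hf [[g Hg] no]. split.
  - exists (fun x => g (f x)). intros x y E. apply Hf, Hg, E.
  - intros [h Hh]. apply no. exists (fun k => f (h k)). intros x y E. apply Hh, Hf, E.
Qed.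

Lemma card_lt_surj (X Y : Type) (f : X -> Y) :
  (forall y, exists x, f x = y) -> card_lt K X -> card_lt K Y.
Proof.
  intros Hf. apply card_lt_le with
    (f := fun y => proj1_sig (constructive_indefinite_description _ (Hf y))).
  intros y y'. destruct constructive_indefinite_description as [x E].
  destruct constructive_indefinite_description as [x' E']. cbn. intros ->. congruence.
Qed.

(** The largest of the three types is itself below [K] and infinite, so it serves as [B] and absorbs
    its lists. *)
Lemma card_lt_dominated (X Y Z : Type) :
  card_lt K X -> card_lt K Y -> card_lt K Z -> (exists j : nat -> Z, injective j) ->
  exists B, card_lt K B /\ (exists i : X -> B, injective i) /\
    (exists i : Y -> B, injective i) /\ (exists i : Z -> B, injective i) /\
    (exists c : list B -> B, injective c).
Proof.
  assert (comp : forall U V W (f : U -> V) (g : V -> W), injective f -> injective g ->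
            exists h : U -> W, injective h).
  { intros U V W f g Hf Hg. exists (fun u => g (f u)). intros u u' E. apply Hf, Hg, E. }
  assert (id : forall U, exists f : U -> U, injective f).
  { intros U. exists (fun u => u). intros u v E. exact E. }
  assert (two : forall U V, card_lt K U -> card_lt K V -> exists B, card_lt K B /\
            (exists i : U -> B, injective i) /\ (exists i : V -> B, injective i)).
  { intros U V HU HV. destruct (cardinals_comparable U V) as [H | H]; [exists V | exists U]; auto. }
  intros HX HY HZ [j Hj].
  destruct (two X Y HX HY) as [B1 [H1 [[i1 Hi1] [i2 Hi2]]]].
  destruct (two B1 Z H1 HZ) as [B [HB [[i3 Hi3] [i4 Hi4]]]].
  exists B. split; [exact HB |].
  split; [exact (comp _ _ _ i1 i3 Hi1 Hi3) |].
  split; [exact (comp _ _ _ i2 i3 Hi2 Hi3) |].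
  split; [exists i4; exact Hi4 |].
  apply injective_list_of_infinite. exact (comp _ _ _ j i4 Hj Hi4).
Qed.

Lemma card_lt_sum (X Y : Type) :
  card_lt K nat -> card_lt K X -> card_lt K Y -> card_lt K (X + Y).
Proof.
  intros Hn HX HY.
  assert (Hid : exists j : nat -> nat, injective j).
  { exists (fun n => n). intros n m E. exact E. }
  destruct (card_lt_dominated HX HY Hn Hid) as
    [B [HB [[i Hi] [[j Hj] [[k Hk] [c Hc]]]]]].
  apply card_lt_le with (f := fun s : X + Y =>
    match s with inl x => c [k 0; i x] | inr y => c [k 1; j y] end); [| exact HB].
  intros [x | y] [x' | y'] E; apply Hc in E.
  - injection E as E. f_equal. apply Hi, E.
  - injection E as E _. apply Hk in E. discriminate.
  - injection E as E _. apply Hk in E. discriminate.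
  - injection E as E. f_equal. apply Hj, E.
Qed.
End Cardinals.

(** * Syntax and substitution *)

Lemma term_nested_ind (L : language) (P : Type) (Q : term L P -> Prop) :
  (forall n, Q (tvar n)) -> (forall p, Q (tpar p)) ->
  (forall f ts, Forall Q ts -> Q (tapp f ts)) -> forall t, Q t.
Proof.
  intros Hv Hp Ha. fix IH 1. intros [n | p | f ts]; [apply Hv | apply Hp |].
  apply Ha. induction ts as [| t ts IHts]; constructor; [apply IH | exact IHts].
Qed.

Section Syntax.
Variable L : language.

Lemma tparams_in_app (P : Type) (A : P -> Prop) (f : func L) (ts : list (term L P)) :
  tparams_in A (tapp f ts) <-> Forall (tparams_in A) ts.
Proof.
  cbn. induction ts as [| t ts IH]; [split; auto |].
  rewrite Forall_cons_iff, <- IH. reflexivity.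
Qed.

Lemma tsparams_in_iff (P : Type) (A : P -> Prop) (ts : list (term L P)) :
  tsparams_in A ts <-> Forall (tparams_in A) ts.
Proof.
  induction ts as [| t ts IH]; cbn; [split; auto |]. rewrite Forall_cons_iff, <- IH. reflexivity.
Qed.

Lemma tbound_app (P : Type) (k : nat) (f : func L) (ts : list (term L P)) :
  tbound k (tapp f ts) <-> Forall (tbound k) ts.
Proof.
  cbn. induction ts as [| t ts IH]; [split; auto |].
  rewrite Forall_cons_iff, <- IH. reflexivity.
Qed.

Lemma tsbound_iff (P : Type) (k : nat) (ts : list (term L P)) :
  tsbound k ts <-> Forall (tbound k) ts.
Proof.
  induction ts as [| t ts IH]; cbn; [split; auto |]. rewrite Forall_cons_iff, <- IH. reflexivity.
Qed.

Lemma tbound_mono (P : Type) (k k' : nat) (t : term L P) : k <= k' -> tbound k t -> tbound k' t.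
Proof.
  intros le. induction t as [n | p | f ts IH] using term_nested_ind; [cbn; lia | auto |].
  rewrite !tbound_app, !Forall_forall. rewrite Forall_forall in IH. auto.
Qed.

Lemma fbound_mono (P : Type) (phi : formula L P) :
  forall k k', k <= k' -> fbound k phi -> fbound k' phi.
Proof.
  induction phi as [t1 t2 | r ts | f IH | f IHf g IHg | f IH]; cbn; intros k k' le.
  - intros [H1 H2]. split; [exact (tbound_mono _ le H1) | exact (tbound_mono _ le H2)].
  - rewrite !tsbound_iff. apply Forall_impl. intros t. exact (tbound_mono t le).
  - apply IH, le.
  - intros [H1 H2]. eauto.
  - apply IH. lia.
Qed.

Lemma Forall_eventually (X : Type) (Q : nat -> X -> Prop) (l : list X) :
  (forall k k' x, k <= k' -> Q k x -> Q k' x) ->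
  Forall (fun x => exists k, Q k x) l -> exists k, Forall (Q k) l.
Proof.
  intros mono F. induction F as [| x l [k Hk] F [k' Hk']]; [exists 0; auto |].
  exists (max k k'). constructor; [| revert Hk'; apply Forall_impl; intros y].
  - apply (mono k); [lia | exact Hk].
  - apply mono. lia.
Qed.

Lemma tbound_exists (P : Type) (t : term L P) : exists k, tbound k t.
Proof.
  induction t as [n | p | f ts IH] using term_nested_ind; [exists (S n); cbn; lia | exists 0; exact I |].
  destruct (Forall_eventually (fun k (t : term L P) => tbound k t)
    (fun k k' t le => @tbound_mono P k k' t le) IH) as [k Hk].
  exists k. apply tbound_app, Hk.
Qed.

Lemma fbound_exists (P : Type) (phi : formula L P) : exists k, fbound k phi.
Proof.
  induction phi as [t1 t2 | r ts | f IH | f [k Hk] g [k' Hk'] | f [k Hk]]; cbn.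
  - destruct (tbound_exists t1) as [k Hk]. destruct (tbound_exists t2) as [k' Hk'].
    exists (max k k'). split; eapply tbound_mono; try eassumption; lia.
  - destruct (Forall_eventually (fun k (t : term L P) => tbound k t)
      (fun k k' t le => @tbound_mono P k k' t le) (l := ts)) as [k Hk].
    + apply Forall_forall. intros t _. apply tbound_exists.
    + exists k. apply tsbound_iff, Hk.
  - exact IH.
  - exists (max k k'). split; eapply fbound_mono; try eassumption; lia.
  - exists k. eapply fbound_mono; [| exact Hk]. lia.
Qed.

Lemma tparams_in_mono (P : Type) (A B : P -> Prop) (t : term L P) :
  (forall p, A p -> B p) -> tparams_in A t -> tparams_in B t.
Proof.
  intros AB. induction t as [n | p | f ts IH] using term_nested_ind; [auto | apply AB |].
  rewrite !tparams_in_app, !Forall_forall. rewrite Forall_forall in IH. auto.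
Qed.

Lemma params_in_mono (P : Type) (A B : P -> Prop) (phi : formula L P) :
  (forall p, A p -> B p) -> params_in A phi -> params_in B phi.
Proof.
  intros AB. induction phi as [t1 t2 | r ts | f IH | f IHf g IHg | f IH]; cbn; auto.
  - intros [H1 H2]. split; eapply tparams_in_mono; eauto.
  - rewrite !tsparams_in_iff. apply Forall_impl. intros t. apply tparams_in_mono. exact AB.
  - intros [H1 H2]. auto.
Qed.

Section Chains.
Variables (P : Type) (N : nat -> P -> Prop).
Hypothesis N_mono : forall k k' p, k <= k' -> N k p -> N k' p.

Lemma tparams_in_chain (t : term L P) :
  tparams_in (fun p => exists k, N k p) t -> exists k, tparams_in (N k) t.
Proof.
  induction t as [n | p | f ts IH] using term_nested_ind.
  - exists 0. exact I.
  - intros [k Hk]. exists k. exact Hk.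
  - rewrite tparams_in_app. intros H.
    destruct (Forall_eventually (fun k (t : term L P) => tparams_in (N k) t) (l := ts)) as [k Hk].
    + intros k k' t le. apply tparams_in_mono. intros p. apply N_mono. exact le.
    + rewrite Forall_forall in *. auto.
    + exists k. apply tparams_in_app, Hk.
Qed.

(** A formula has finitely many parameters. This serves the union of the stages of a Skolem hull,
    and also extracts numerical bounds on indices attached to parameters. *)
Lemma params_in_chain (phi : formula L P) :
  params_in (fun p => exists k, N k p) phi -> exists k, params_in (N k) phi.
Proof.
  assert (up : forall k k' (psi : formula L P), k <= k' -> params_in (N k) psi -> params_in (N k') psi).
  { intros k k' psi le. apply params_in_mono. intros p. apply N_mono. exact le. }
  induction phi as [t1 t2 | r ts | f IH | f IHf g IHg | f IH]; cbn; auto.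
  - intros [H1 H2]. destruct (tparams_in_chain _ H1) as [k Hk].
    destruct (tparams_in_chain _ H2) as [k' Hk'].
    exists (max k k'). split; eapply tparams_in_mono; try eassumption;
      intros p; (eapply N_mono; lia).
  - rewrite tsparams_in_iff. intros H.
    destruct (Forall_eventually (fun k (t : term L P) => tparams_in (N k) t) (l := ts)) as [k Hk].
    + intros k k' t le. apply tparams_in_mono. intros p. apply N_mono. exact le.
    + rewrite Forall_forall in *. intros t Ht. apply tparams_in_chain, H, Ht.
    + exists k. apply tsparams_in_iff, Hk.
  - intros [H1 H2]. destruct (IHf H1) as [k Hk]. destruct (IHg H2) as [k' Hk'].
    exists (max k k'). split; eapply up; try eassumption; lia.
Qed.
End Chains.

(* A substitution sends variables and parameters to variables ([inl]) or
   parameters ([inr]). *)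
Definition atom_shift (P : Type) (a : nat + P) : nat + P :=
  match a with inl n => inl (S n) | inr p => inr p end.

Definition subst_up (P : Type) (v : nat -> nat + P) (n : nat) : nat + P :=
  match n with 0 => inl 0 | S n => atom_shift (v n) end.

Definition atom_term (P : Type) (a : nat + P) : term L P :=
  match a with inl n => tvar n | inr p => tpar p end.

Fixpoint tsub (P P' : Type) (v : nat -> nat + P') (w : P -> nat + P') (t : term L P) : term L P' :=
  match t with
  | tvar n => atom_term (v n)
  | tpar p => atom_term (w p)
  | tapp f ts => tapp f (map (tsub v w) ts)
  end.

Fixpoint fsub (P P' : Type) (v : nat -> nat + P') (w : P -> nat + P') (phi : formula L P) :
  formula L P' :=
  match phi with
  | feq t1 t2 => feq (tsub v w t1) (tsub v w t2)
  | frel r ts => frel r (map (tsub v w) ts)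
  | fneg f => fneg (fsub v w f)
  | fand f g => fand (fsub v w f) (fsub v w g)
  | fex f => fex (fsub (subst_up v) (fun p => atom_shift (w p)) f)
  end.

Definition atom_ok (P : Type) (k : nat) (A : P -> Prop) (a : nat + P) : Prop :=
  match a with inl n => n < k | inr p => A p end.

Lemma atom_ok_shift (P : Type) (k : nat) (A : P -> Prop) (a : nat + P) :
  atom_ok k A a -> atom_ok (S k) A (atom_shift a).
Proof. destruct a; cbn; [lia | auto]. Qed.

Lemma atom_term_ok (P : Type) (k : nat) (A : P -> Prop) (a : nat + P) :
  atom_ok k A a -> tbound k (atom_term a) /\ tparams_in A (atom_term a).
Proof. destruct a; cbn; auto. Qed.

Lemma tsub_ok (P P' : Type) (k k' : nat) (A : P -> Prop) (A' : P' -> Prop) v w (t : term L P) :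
  (forall n, n < k -> atom_ok k' A' (v n)) -> (forall p, A p -> atom_ok k' A' (w p)) ->
  tbound k t -> tparams_in A t -> tbound k' (tsub v w t) /\ tparams_in A' (tsub v w t).
Proof.
  intros Hv Hw. induction t as [n | p | f ts IH] using term_nested_ind; intros H1 H2.
  - apply (atom_term_ok k'). apply Hv. exact H1.
  - apply (atom_term_ok k'). apply Hw. exact H2.
  - rewrite tbound_app in H1. rewrite tparams_in_app in H2.
    change (tsub v w (tapp f ts)) with (tapp f (map (tsub v w) ts)).
    rewrite tbound_app, tparams_in_app, !Forall_map. rewrite Forall_forall in IH, H1, H2.
    split; apply Forall_forall; intros t Ht; destruct (IH t Ht (H1 t Ht) (H2 t Ht)); assumption.
Qed.

Lemma fsub_ok (P P' : Type) (A : P -> Prop) (A' : P' -> Prop) (phi : formula L P) :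
  forall k k' v w,
  (forall n, n < k -> atom_ok k' A' (v n)) -> (forall p, A p -> atom_ok k' A' (w p)) ->
  fbound k phi -> params_in A phi -> fbound k' (fsub v w phi) /\ params_in A' (fsub v w phi).
Proof.
  induction phi as [t1 t2 | r ts | f IH | f IHf g IHg | f IH]; intros k k' v w Hv Hw; cbn.
  - intros [H1 H2] [H3 H4].
    destruct (tsub_ok k' A A' v w t1 Hv Hw H1 H3). destruct (tsub_ok k' A A' v w t2 Hv Hw H2 H4). auto.
  - rewrite !tsbound_iff, !tsparams_in_iff, !Forall_map, !Forall_forall. intros H1 H2.
    split; intros t Ht;
      destruct (tsub_ok k' A A' v w t Hv Hw (H1 t Ht) (H2 t Ht)); assumption.
  - apply IH; assumption.
  - intros [H1 H2] [H3 H4].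
    destruct (IHf k k' v w Hv Hw H1 H3). destruct (IHg k k' v w Hv Hw H2 H4). auto.
  - apply IH.
    + intros [| n] lt; cbn; [lia |]. apply atom_ok_shift, Hv. lia.
    + intros p Ap. apply atom_ok_shift, Hw, Ap.
Qed.

Lemma params_in_full (P : Type) (phi : formula L P) : params_in (fun _ => True) phi.
Proof.
  assert (T : forall t : term L P, tparams_in (fun _ => True) t).
  { intros t. induction t as [n | p | f ts IH] using term_nested_ind; [exact I | exact I |].
    apply tparams_in_app, IH. }
  induction phi; cbn; auto. apply tsparams_in_iff, Forall_forall. auto.
Qed.

Fixpoint fexn (P : Type) (n : nat) (phi : formula L P) : formula L P :=
  match n with 0 => phi | S n => fex (fexn n phi) end.

Lemma fexn_bound (P : Type) (n : nat) (phi : formula L P) :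
  forall k, fbound (n + k) phi -> fbound k (fexn n phi).
Proof.
  induction n as [| n IH]; cbn; intros k H; [exact H |].
  apply IH. replace (n + S k) with (S (n + k)) by lia. exact H.
Qed.

Lemma fexn_params (P : Type) (A : P -> Prop) (n : nat) (phi : formula L P) :
  params_in A phi -> params_in A (fexn n phi).
Proof. induction n; cbn; auto. Qed.

Definition fconj (P : Type) (l : list (formula L P)) : formula L P :=
  fold_right (@fand L P) (feq (tvar 0) (tvar 0)) l.

Lemma fconj_params (P : Type) (A : P -> Prop) (l : list (formula L P)) :
  (forall phi, In phi l -> params_in A phi) -> params_in A (fconj l).
Proof. induction l as [| phi l IH]; cbn; auto. Qed.

End Syntax.

Section Semantics.
Variable L : language.
Variable M : structure L.

(** Keeping the parameters abstract, with a valuation [pi], allows formulas over a set of codes and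
    turns the action of an automorphism on parameters into a change of [pi]. *)
Fixpoint geval (P : Type) (pi : P -> M) (e : nat -> M) (t : term L P) : M :=
  match t with
  | tvar n => e n
  | tpar p => pi p
  | tapp f ts => ifunc M f (map (geval pi e) ts)
  end.

Fixpoint gsat (P : Type) (pi : P -> M) (e : nat -> M) (phi : formula L P) : Prop :=
  match phi with
  | feq t1 t2 => geval pi e t1 = geval pi e t2
  | frel r ts => irel M r (map (geval pi e) ts)
  | fneg f => ~ gsat pi e f
  | fand f g => gsat pi e f /\ gsat pi e g
  | fex f => exists c : M, gsat pi (scons c e) f
  end.

Lemma geval_id (e : nat -> M) (t : term L M) : geval (fun x => x) e t = teval M e t.
Proof.
  induction t as [n | p | f ts IH] using term_nested_ind; cbn; try reflexivity.
  f_equal. apply map_ext_Forall, IH.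
Qed.

Lemma gsat_id (phi : mformula M) : forall e, gsat (fun x => x) e phi <-> sat e phi.
Proof.
  induction phi as [t1 t2 | r ts | f IH | f IHf g IHg | f IH]; intros e; cbn.
  - rewrite !geval_id. reflexivity.
  - rewrite (map_ext _ _ (geval_id e)). reflexivity.
  - rewrite IH. reflexivity.
  - rewrite IHf, IHg. reflexivity.
  - split; intros [c H]; exists c; apply IH, H.
Qed.

Lemma geval_ext (P : Type) (k : nat) (A : P -> Prop) (pi pi' : P -> M) (e e' : nat -> M)
  (t : term L P) :
  (forall n, n < k -> e n = e' n) -> (forall p, A p -> pi p = pi' p) ->
  tbound k t -> tparams_in A t -> geval pi e t = geval pi' e' t.
Proof.
  intros He Hp. induction t as [n | p | f ts IH] using term_nested_ind; intros H1 H2.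
  - apply He, H1.
  - apply Hp, H2.
  - rewrite tbound_app in H1. rewrite tparams_in_app in H2. cbn. f_equal.
    apply map_ext_in. rewrite Forall_forall in *. auto.
Qed.

Lemma gsat_ext (P : Type) (A : P -> Prop) (pi pi' : P -> M) (phi : formula L P) :
  (forall p, A p -> pi p = pi' p) -> params_in A phi -> forall k (e e' : nat -> M), 
  fbound k phi -> (forall n, n < k -> e n = e' n) -> gsat pi e phi <-> gsat pi' e' phi.
Proof.
  intros Hp. induction phi as [t1 t2 | r ts | f IH | f IHf g IHg | f IH]; cbn; intros HA k e e' Hb He.
  - destruct HA, Hb. rewrite (geval_ext A pi pi' e e' t1 He Hp), (geval_ext A pi pi' e e' t2 He Hp); tauto.
  - rewrite tsbound_iff in Hb. rewrite tsparams_in_iff in HA. rewrite Forall_forall in *.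
    rewrite (map_ext_in (geval pi e) (geval pi' e') ts); [reflexivity |].
    intros t Ht. eapply geval_ext; eauto.
  - rewrite (IH HA k e e' Hb He). reflexivity.
  - destruct HA, Hb. rewrite (IHf H k e e'), (IHg H0 k e e'); tauto.
  - assert (E : forall c, gsat pi (scons c e) f <-> gsat pi' (scons c e') f).
    { intros c. apply IH with (k := S k); auto. intros [| n] lt; cbn; [reflexivity |]. apply He. lia. }
    split; intros [c H]; exists c; apply E, H.
Qed.

Lemma sat_ext (k : nat) (phi : mformula M) (e e' : nat -> M) :
  fbound k phi -> (forall n, n < k -> e n = e' n) -> sat e phi <-> sat e' phi.
Proof.
  intros Hb He. rewrite <- !gsat_id.
  apply gsat_ext with (A := fun _ => True) (k := k); auto using params_in_full.
Qed.

Lemma sat_eq_env (phi : mformula M) (e e' : nat -> M) :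
  (forall n, e n = e' n) -> sat e phi <-> sat e' phi.
Proof. intros E. destruct (fbound_exists phi) as [k Hk]. apply sat_ext with (k := k); auto. Qed.

Definition atom_val (P : Type) (pi : P -> M) (e : nat -> M) (a : nat + P) : M :=
  match a with inl n => e n | inr p => pi p end.

Lemma geval_sub (P P' : Type) v w (pi : P' -> M) (e : nat -> M) (t : term L P) :
  geval pi e (tsub v w t) =
  geval (fun p => atom_val pi e (w p)) (fun n => atom_val pi e (v n)) t.
Proof.
  induction t as [n | p | f ts IH] using term_nested_ind; cbn.
  - destruct (v n); reflexivity.
  - destruct (w p); reflexivity.
  - rewrite map_map. f_equal. apply map_ext_Forall, IH.
Qed.

Lemma atom_val_shift (P : Type) (pi : P -> M) (e : nat -> M) (c : M) (a : nat + P) :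
  atom_val pi (scons c e) (atom_shift a) = atom_val pi e a.
Proof. destruct a; reflexivity. Qed.

Lemma gsat_sub (P P' : Type) (pi : P' -> M) (phi : formula L P) : forall v w (e : nat -> M),
  gsat pi e (fsub v w phi) <->
  gsat (fun p => atom_val pi e (w p)) (fun n => atom_val pi e (v n)) phi.
Proof.
  induction phi as [t1 t2 | r ts | f IH | f IHf g IHg | f IH]; intros v w e; cbn.
  - rewrite !geval_sub. reflexivity.
  - rewrite map_map, (map_ext _ _ (fun t => geval_sub v w pi e t)). reflexivity.
  - rewrite IH. reflexivity.
  - rewrite IHf, IHg. reflexivity.
  - assert (E : forall c, gsat pi (scons c e) (fsub (subst_up v) (fun p => atom_shift (w p)) f) <->
      gsat (fun p => atom_val pi e (w p)) (scons c (fun n => atom_val pi e (v n))) f).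
    { intros c. rewrite IH. destruct (fbound_exists f) as [k Hk].
      apply gsat_ext with (A := fun _ => True) (k := k); auto using params_in_full.
      - intros p _. apply atom_val_shift.
      - intros [| n] _; [reflexivity | apply atom_val_shift]. }
    split; intros [c H]; exists c; apply E, H.
Qed.

Lemma sat_sub (v : nat -> nat + M) (w : M -> nat + M) (phi : mformula M) (e : nat -> M) :
  sat e (fsub v w phi) <->
  gsat (fun p => atom_val (fun x => x) e (w p)) (fun n => atom_val (fun x => x) e (v n)) phi.
Proof. rewrite <- gsat_id. apply gsat_sub. Qed.

Lemma sat_sub_vars (v : nat -> nat + M) (phi : mformula M) (e : nat -> M) :
  sat e (fsub v (fun p => inr p) phi) <-> sat (fun n => atom_val (fun x => x) e (v n)) phi.
Proof. rewrite sat_sub. apply gsat_id. Qed.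

Lemma geval_auto (s : M -> M) (P : Type) (pi : P -> M) (e : nat -> M) (t : term L P) :
  automorphism M s -> geval (fun p => s (pi p)) (fun n => s (e n)) t = s (geval pi e t).
Proof.
  intros [_ [Hf _]]. induction t as [n | p | f ts IH] using term_nested_ind; cbn; auto.
  rewrite Hf, map_map. f_equal. apply map_ext_Forall, IH.
Qed.

Lemma gsat_auto (s : M -> M) (P : Type) (pi : P -> M) (phi : formula L P) : 
  automorphism M s -> forall e : nat -> M,
  gsat (fun p => s (pi p)) (fun n => s (e n)) phi <-> gsat pi e phi.
Proof.
  intros aut. pose proof aut as [[s' [s's ss']] [_ Hr]].
  induction phi as [t1 t2 | r ts | f IH | f IHf g IHg | f IH]; intros e; cbn.
  - rewrite !geval_auto by exact aut. split; [| congruence].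
    intros E. rewrite <- (s's (geval pi e t1)), E. apply s's.
  - rewrite (Hr r (map (geval pi e) ts)), map_map.
    rewrite (map_ext _ _ (fun t => geval_auto pi e t aut)). reflexivity.
  - rewrite IH. reflexivity.
  - rewrite IHf, IHg. reflexivity.
  - assert (E : forall c, gsat (fun p => s (pi p)) (scons (s c) (fun n => s (e n))) f <->
                          gsat pi (scons c e) f).
    { intros c. rewrite <- IH. destruct (fbound_exists f) as [k Hk].
      apply gsat_ext with (A := fun _ => True) (k := k); auto using params_in_full.
      intros [| n] _; reflexivity. }
    split; intros [c H].
    + exists (s' c). apply E. rewrite ss'. exact H.
    + exists (s c). apply E, H.
Qed.

Definition fmove (s : M -> M) (phi : mformula M) : mformula M :=
  fsub (fun n => inl n) (fun p => inr (s p)) phi.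

Lemma sat_fmove (s : M -> M) (phi : mformula M) (e : nat -> M) :
  automorphism M s -> sat (fun n => s (e n)) (fmove s phi) <-> sat e phi.
Proof.
  intros aut. unfold fmove. rewrite sat_sub. cbn. rewrite <- gsat_id.
  exact (gsat_auto (fun x => x) phi aut e).
Qed.

Lemma fmove_ok (s : M -> M) (A B : M -> Prop) (k : nat) (phi : mformula M) :
  (forall x, A x -> B (s x)) -> fbound k phi -> params_in A phi ->
  fbound k (fmove s phi) /\ params_in B (fmove s phi).
Proof. intros AB. apply fsub_ok; cbn; auto. Qed.

Lemma sat_auto_fixing (s : M -> M) (A : M -> Prop) (phi : mformula M) (e : nat -> M) :
  automorphism M s -> (forall x, A x -> s x = x) -> params_in A phi ->
  sat (fun n => s (e n)) phi <-> sat e phi.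
Proof.
  intros aut fix_A HA. rewrite <- !gsat_id. rewrite <- (gsat_auto (fun x => x) phi aut e).
  destruct (fbound_exists phi) as [k Hk].
  apply gsat_ext with (A := A) (k := k); auto. intros p Ap. symmetry. auto.
Qed.

Lemma sat_fexn (phi : mformula M) (n : nat) : forall e : nat -> M,
  sat e (fexn n phi) <->
  exists d : nat -> M, sat (fun i => if i <? n then d i else e (i - n)) phi.
Proof.
  induction n as [| n IH]; intros e; cbn [fexn sat].
  - split.
    + intros H. exists e. revert H. apply sat_eq_env. intros i. cbn. f_equal. lia.
    + intros [d H]. revert H. apply sat_eq_env. intros i. cbn. f_equal. lia.
  - split.
    + intros [c H]. apply IH in H. destruct H as [d H].
      exists (fun i => if i <? n then d i else c). revert H. apply sat_eq_env. intros i.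
      destruct (Nat.ltb_spec i n), (Nat.ltb_spec i (S n)); try reflexivity; try lia.
      * replace (i - n) with 0 by lia. reflexivity.
      * replace (i - n) with (S (i - S n)) by lia. reflexivity.
    + intros [d H]. exists (d n). apply IH. exists d. revert H. apply sat_eq_env. intros i.
      destruct (Nat.ltb_spec i n), (Nat.ltb_spec i (S n)); try reflexivity; try lia.
      * replace i with n by lia. rewrite Nat.sub_diag. reflexivity.
      * replace (i - n) with (S (i - S n)) by lia. reflexivity.
Qed.

Lemma sat_fconj (l : list (mformula M)) (e : nat -> M) :
  sat e (fconj l) <-> forall phi, In phi l -> sat e phi.
Proof.
  induction l as [| phi l IH]; cbn [fconj fold_right sat].
  - split; [intros _ phi [] | reflexivity].
  - unfold fconj in IH. rewrite IH. split.
    + intros [H1 H2] psi [<- | Hpsi]; auto.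
    + intros H. split; [apply H; left; reflexivity |]. intros psi Hpsi. apply H. right. exact Hpsi.
Qed.

Lemma automorphism_id : automorphism M (fun x => x).
Proof.
  split; [exists (fun x => x); auto |]. split; intros; rewrite map_id; reflexivity.
Qed.

Lemma automorphism_compose (s t : M -> M) :
  automorphism M s -> automorphism M t -> automorphism M (fun x => s (t x)).
Proof.
  intros [[s' [s's ss']] [sf sr]] [[t' [t't tt']] [tf tr]]. split; [| split].
  - exists (fun x => t' (s' x)). split; intros x; [rewrite s's; apply t't | rewrite tt'; apply ss'].
  - intros f l. rewrite tf, sf, map_map. reflexivity.
  - intros r l. rewrite tr, sr, map_map. reflexivity.
Qed.

Lemma automorphism_inverse (s : M -> M) :
  automorphism M s ->
  exists s', automorphism M s' /\ (forall x, s' (s x) = x) /\ (forall x, s (s' x) = x).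
Proof.
  intros [[s' [s's ss']] [sf sr]]. exists s'. split; [| auto].
  assert (mm : forall l, map s (map s' l) = l).
  { intros l. rewrite map_map. rewrite (map_ext _ (fun x => x)); [apply map_id | exact ss']. }
  split; [exists s; auto | split].
  - intros f l. rewrite <- (s's (ifunc M f (map s' l))), sf, mm. reflexivity.
  - intros r l. rewrite (sr r (map s' l)), mm. reflexivity.
Qed.
End Semantics.

(** * Monster models *)

Section FormulaCoding.
Variables (L : language) (B : Type) (i : nat -> B) (j : func L + rel L -> B) (c : list B -> B).
Hypotheses (i_inj : injective i) (j_inj : injective j) (c_inj : injective c).

Fixpoint term_code (t : term L B) : B :=
  match t with
  | tvar n => c [i 0; i n]
  | tpar b => c [i 1; b]
  | tapp f ts => c (i 2 :: j (inl f) :: map term_code ts)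
  end.

Fixpoint formula_code (phi : formula L B) : B :=
  match phi with
  | feq t1 t2 => c [i 0; term_code t1; term_code t2]
  | frel r ts => c (i 1 :: j (inr r) :: map term_code ts)
  | fneg f => c [i 2; formula_code f]
  | fand f g => c [i 3; formula_code f; formula_code g]
  | fex f => c [i 4; formula_code f]
  end.

Lemma code_cons (n m : nat) (l l' : list B) :
  c (i n :: l) = c (i m :: l') -> n = m /\ l = l'.
Proof. intros E. apply c_inj in E. split; [apply i_inj |]; congruence. Qed.

Lemma term_code_injective : injective term_code.
Proof.
  intros t. induction t as [n | p | f ts IH] using term_nested_ind; intros [m | q | g us] E;
  cbn in E; apply code_cons in E; destruct E as [E1 E]; try discriminate.
  - injection E as E. apply i_inj in E. congruence.
  - congruence.
  - injection E as E2 E3. apply j_inj in E2. injection E2 as ->. f_equal.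
    revert us E3. induction IH as [| t ts Ht _ IH]; intros [| u us] E3; try discriminate; [reflexivity |].
    injection E3 as E3 E4. f_equal; auto.
Qed.

Lemma formula_code_injective : injective formula_code.
Proof.
  intros phi. induction phi; intros [] E; cbn in E; apply code_cons in E;
  destruct E as [E1 E]; try discriminate; injection E as E.
  - f_equal; apply term_code_injective; assumption.
  - apply j_inj in E. injection E as ->. f_equal. revert H. apply injective_map, term_code_injective.
  - f_equal. auto.
  - f_equal; auto.
  - f_equal. auto.
Qed.
End FormulaCoding.

Section Monster.
Variables (L : language) (M : structure L) (K : Type).

Definition one_type (A : M -> Prop) (x : M) : mformula M -> Prop :=
  fun phi => fbound 1 phi /\ params_in A phi /\ sat (env1 x) phi.

Lemma one_type_complete (A : M -> Prop) (x : M) : complete_1type A (one_type A x).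
Proof.
  split; [| split].
  - intros phi [H1 [H2 _]]. auto.
  - intros l Hl. exists x. intros phi Hphi. apply Hl, Hphi.
  - intros phi H1 H2. destruct (classic (sat (env1 x) phi)) as [H | H].
    + left. repeat split; assumption.
    + right. repeat split; assumption.
Qed.

Lemma realizes_one_type (A : M -> Prop) (x : M) : realizes (one_type A x) x.
Proof. intros phi [_ [_ H]]. exact H. Qed.

Lemma realizes_iff (A : M -> Prop) (p : mformula M -> Prop) (x : M) (phi : mformula M) :
  complete_1type A p -> realizes p x -> fbound 1 phi -> params_in A phi ->
  sat (env1 x) phi <-> p phi.
Proof.
  intros [_ [_ cp]] px H1 H2. split; [| apply px].
  intros H. destruct (cp phi H1 H2) as [pphi | npphi]; [exact pphi |].
  exfalso. exact (px _ npphi H).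
Qed.

Lemma realizes_auto (A : M -> Prop) (p : mformula M -> Prop) (s : M -> M) (x : M) :
  complete_1type A p -> automorphism M s -> (forall y, A y -> s y = y) ->
  realizes p (s x) <-> realizes p x.
Proof.
  intros [pA _] aut fix_A.
  assert (E : forall phi, p phi -> sat (env1 (s x)) phi <-> sat (env1 x) phi).
  { intros phi pphi. apply (@sat_auto_fixing L M s A phi (env1 x) aut fix_A). apply pA, pphi. }
  split; intros H phi pphi; apply E; auto.
Qed.

Hypothesis mon : monster M K.

Lemma small_sub (A B : M -> Prop) : (forall x, A x -> B x) -> small M K B -> small M K A.
Proof.
  intros AB. unfold small. apply card_lt_le with
    (f := fun a : {x | A x} => exist B (proj1_sig a) (AB _ (proj2_sig a))).
  intros [a Ha] [b Hb] E. cbn in E. injection E as ->. f_equal. apply proof_irrelevance.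
Qed.

Lemma small_surj (X : Type) (f : X -> M) :
  card_lt K X -> small M K (fun x => exists y, f y = x).
Proof.
  apply card_lt_surj with (f := fun y => exist (fun x => exists y, f y = x) (f y) (ex_intro _ y eq_refl)).
  intros [x [y <-]]. exists y. reflexivity.
Qed.

Lemma small_range (f : nat -> M) : small M K (fun x => exists n, f n = x).
Proof. apply small_surj, mon. Qed.

Lemma small_list (l : list M) : small M K (fun x => In x l).
Proof.
  destruct l as [| y l].
  - destruct (carrier_inhabited M) as [y]. apply small_sub with (2 := small_range (fun _ => y)).
    intros x [].
  - apply small_sub with (2 := small_range (fun n => nth n (y :: l) y)).
    intros x Hx. destruct (In_nth _ _ y Hx) as [n [_ E]]. eauto.
Qed.

Lemma small_union (A B : M -> Prop) :
  small M K A -> small M K B -> small M K (fun x => A x \/ B x).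
Proof.
  intros HA HB. destruct (carrier_inhabited M) as [m].
  apply small_sub with (2 := small_surj (fun s : {x | A x} + {x | B x} =>
     match s with inl a => proj1_sig a | inr b => proj1_sig b end)
     (card_lt_sum (proj1 mon) HA HB)).
  intros x [Ax | Bx]; [exists (inl (exist _ x Ax)) | exists (inr (exist _ x Bx))]; reflexivity.
Qed.

Lemma small_add (A : M -> Prop) (x : M) : small M K A -> small M K (fun y => A y \/ y = x).
Proof.
  intros HA. apply small_union; [exact HA |].
  apply small_sub with (2 := small_list [x]). intros y ->. left. reflexivity.
Qed.

Lemma complete_realized (A : M -> Prop) (p : mformula M -> Prop) :
  small M K A -> complete_1type A p -> exists x, realizes p x.
Proof.
  intros HA [pA [fin _]]. destruct mon as [_ [_ [sat_ _]]].
  exact (sat_ A p HA pA fin).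
Qed.

(** Strong homogeneity concerns maps preserving formulas in any number of variables. For the map
    moving only [x], such formulas reduce to one-variable formulas over [A]. *)
Lemma automorphism_of_types (A : M -> Prop) (x y : M) :
  small M K A ->
  (forall phi, fbound 1 phi -> params_in A phi -> sat (env1 x) phi -> sat (env1 y) phi) ->
  exists s, automorphism M s /\ (forall z, A z -> s z = z) /\ s x = y.
Proof.
  intros HA xy.
  assert (yx : forall phi, fbound 1 phi -> params_in A phi -> sat (env1 x) phi <-> sat (env1 y) phi).
  { intros phi H1 H2. split; [auto |]. intros Hy. apply NNPP. intros Hx. exact (xy (fneg phi) H1 H2 Hx Hy). }
  set (f := fun z => if excluded_middle_informative (z = x) then y else z).
  assert (fx : f x = y).
  { unfold f. destruct excluded_middle_informative; congruence. }
  (* If [x] lies in [A], the formula stating equality with [x] forces [y = x]. *)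
  assert (fA : forall z, A z -> f z = z).
  { intros z Az. unfold f. destruct excluded_middle_informative as [-> |]; [| reflexivity].
    apply (xy (feq (tvar 0) (tpar x))); cbn; auto. }
  destruct mon as [_ [_ [_ hom]]].
  destruct (hom (fun z => A z \/ z = x) f) as [s [aut Hs]].
  - apply small_add, HA.
  - intros phi e pf He.
    (* Coordinates equal to [x] become the variable 0 and all others become parameters from [A]. *)
    set (v := fun n => if excluded_middle_informative (e n = x) then inl 0 else inr (e n)).
    assert (E : forall (z : M) (e' : nat -> M), (forall n, e' n = atom_val M (fun u => u) (env1 z) (v n)) ->
              sat (env1 z) (fsub v (fun p => inr p) phi) <-> sat e' phi).
    { intros z e' He'. rewrite sat_sub_vars. apply sat_eq_env. intros n. symmetry. apply He'. }
    rewrite <- (E x e), <- (E y (fun n => f (e n))).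
    + destruct (fbound_exists phi) as [k Hk].
      destruct (@fsub_ok L M M (fun _ => False) A phi k 1 v (fun p => inr p)) as [H1 H2]; auto.
      * intros n _. unfold v. destruct excluded_middle_informative as [| ne]; cbn; [lia |].
        destruct (He n); tauto.
      * intros p [].
    + intros n. unfold v, f. destruct excluded_middle_informative; reflexivity.
    + intros n. unfold v. destruct excluded_middle_informative as [E' |]; [exact E' | reflexivity].
  - exists s. split; [exact aut |]. split.
    + intros z Az. rewrite Hs by auto. auto.
    + rewrite Hs by auto. exact fx.
Qed.

Lemma automorphism_of_realizations (A : M -> Prop) (p : mformula M -> Prop) (x y : M) :
  small M K A -> complete_1type A p -> realizes p x -> realizes p y ->
  exists s, automorphism M s /\ (forall z, A z -> s z = z) /\ s x = y.
Proof.
  intros HA cp px py. apply automorphism_of_types; [exact HA |].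
  intros phi H1 H2 H. apply py. apply (realizes_iff phi cp px); assumption.
Qed.

(** Downward Löwenheim-Skolem by a Skolem hull. Every stage is the image of a fixed small index set
    [B], whose elements also code the formulas with parameters in [B]; thus all stages have size at
    most that of [B]. *)
Lemma small_elementary_superset (A : M -> Prop) :
  small M K A ->
  exists N, small M K N /\ elementary_substructure M N /\ (forall x, A x -> N x).
Proof.
  intros HA. destruct (carrier_inhabited M) as [m].
  assert (id_nat : exists h : nat -> nat, injective h) by (exists (fun n => n); intros n n' E; exact E).
  destruct (card_lt_dominated HA (proj1 (proj2 mon)) (proj1 mon) id_nat)
    as [B [HB [[a Ha] [[j Hj] [[i Hi] [c Hc]]]]]].
  set (dec := fun b : B => epsilon (inhabits (feq (tvar 0) (tvar 0)))
                (fun phi : formula L B => formula_code i j c phi = b)).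
  assert (Hdec : forall phi, dec (formula_code i j c phi) = phi).
  { intros phi. apply (formula_code_injective Hi Hj Hc).
    apply (epsilon_spec _ (fun psi => formula_code i j c psi = formula_code i j c phi)).
    exists phi. reflexivity. }
  set (witness := fun phi : mformula M => epsilon (inhabits m) (fun x => sat (env1 x) phi)).
  assert (Hwit : forall phi, (exists x, sat (env1 x) phi) -> sat (env1 (witness phi)) phi).
  { intros phi. apply (epsilon_spec (inhabits m) (fun x => sat (env1 x) phi)). }
  set (inst := fun (f : B -> M) (phi : formula L B) =>
                 (fsub (fun n => inl n) (fun b => inr (f b)) phi : mformula M)).
  set (s := fix s (k : nat) : B -> M := match k with
    | 0 => fun b => epsilon (inhabits m) (fun x => exists Ax : A x, a (exist _ x Ax) = b)
    | S k => fun b => witness (inst (s k) (dec b)) end).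
  assert (step : forall k (phi : mformula M), fbound 1 phi -> params_in (fun x => exists b, s k b = x) phi ->
    (exists x, sat (env1 x) phi) -> exists b, sat (env1 (s (S k) b)) phi).
  { intros k phi H1 H2 [x Hx].
    set (g := fun x => epsilon (inhabits (i 0)) (fun b => s k b = x)).
    assert (Hg : forall x, (exists b, s k b = x) -> s k (g x) = x).
    { intros y. apply (epsilon_spec (inhabits (i 0)) (fun b => s k b = y)). }
    set (psi := fsub (fun n => inl n) (fun p => inr (g p)) phi : formula L B).
    assert (E : forall e, sat e (inst (s k) psi) <-> sat e phi).
    { intros e. unfold inst, psi. rewrite <- gsat_id, gsat_sub. cbn. rewrite gsat_sub. cbn.
      rewrite <- (gsat_id phi e). apply gsat_ext with (A := fun x => exists b, s k b = x) (k := 1); auto. }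
    exists (formula_code i j c psi). apply E. cbn [s]. rewrite Hdec. apply Hwit.
    exists x. apply E, Hx. }
  (* An element of stage [k] reappears as the witness of the formula stating equality with it. *)
  assert (mono : forall k k' x, k <= k' -> (exists b, s k b = x) -> exists b, s k' b = x).
  { intros k k' x le Hx. induction le as [| k' le IH]; [exact Hx |].
    destruct (step k' (feq (tvar 0) (tpar x))) as [b Hb].
    - cbn. auto.
    - cbn. auto.
    - exists x. reflexivity.
    - exists b. exact Hb. }
  exists (fun x => exists k b, s k b = x). split; [| split; [split |]].
  - assert (HnB : card_lt K (nat * B)).
    { apply card_lt_le with (f := fun q : nat * B => c [i (fst q); snd q]); [| exact HB].
      intros [n b] [n' b'] E. apply Hc in E. cbn in E. assert (E1 : i n = i n') by congruence.
      apply Hi in E1. congruence. }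
    apply small_sub with (2 := small_surj (fun q : nat * B => s (fst q) (snd q)) HnB).
    intros x [k [b Hb]]. exists (k, b). exact Hb.
  - exists (s 0 (i 0)), 0, (i 0). reflexivity.
  - intros phi H1 H2 Hx.
    destruct (@params_in_chain L M (fun k x => exists b, s k b = x) mono phi H2) as [k Hk].
    destruct (step k phi H1 Hk Hx) as [b Hb]. exists (s (S k) b). eauto.
  - intros x Ax. exists 0, (a (exist _ x Ax)). cbn.
    destruct (epsilon_spec (inhabits m)
      (fun y => exists Ay : A y, a (exist _ y Ay) = a (exist _ x Ax))) as [Ay E].
    + exists x, Ax. reflexivity.
    + apply Ha in E. congruence.
Qed.
End Monster.

(** * Stationarily ordered types and Lascar strong types *)

Section StationarilyOrdered.
Variables (L : language) (M : structure L) (K : Type).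
Hypothesis mon : monster M K.

Definition linear_on (P : M -> Prop) (lt : M -> M -> Prop) : Prop :=
  (forall x, P x -> ~ lt x x) /\
  (forall x y z, P x -> P y -> P z -> lt x y -> lt y z -> lt x z) /\
  (forall x y, P x -> P y -> x <> y -> lt x y \/ lt y x).

(** The comparison of orders conjugates points over [A], and invariance is exactly what this uses;
    it passes to the reversed order. *)
Definition invariant_over (A : M -> Prop) (R : M -> M -> Prop) : Prop :=
  forall s, automorphism M s -> (forall x, A x -> s x = x) ->
  forall x y, R (s x) (s y) <-> R x y.

(** For a linear order, [~ lt u x] means that [x] is at most [u]: any non-empty initial segment
    contains such a closed one. Right ends are treated as left ends of the flipped order. *)
Definition holds_left (P : M -> Prop) (lt : M -> M -> Prop) (X : M -> Prop) : Prop :=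
  exists u, P u /\ forall x, P x -> ~ lt u x -> X x.

Definition decides_left (P : M -> Prop) (lt : M -> M -> Prop) (chi : mformula M) : Prop :=
  holds_left P lt (fun x => sat (env1 x) chi) \/ holds_left P lt (fun x => ~ sat (env1 x) chi).

Definition flip (R : M -> M -> Prop) (x y : M) : Prop := R y x.

Lemma linear_on_flip (P : M -> Prop) (lt : M -> M -> Prop) :
  linear_on P lt -> linear_on P (flip lt).
Proof.
  intros [irr [tr tot]]. unfold flip. split; [exact irr | split].
  - intros x y z Px Py Pz H1 H2. exact (tr z y x Pz Py Px H2 H1).
  - intros x y Px Py ne. destruct (tot x y Px Py ne); auto.
Qed.

Lemma invariant_over_flip (A : M -> Prop) (R : M -> M -> Prop) :
  invariant_over A R -> invariant_over A (flip R).
Proof. intros H s aut fix_A x y. apply H; assumption. Qed.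

Lemma formula_invariant (A : M -> Prop) (phi : mformula M) :
  params_in A phi -> invariant_over A (fun x y => sat (scons x (env1 y)) phi).
Proof.
  intros HA s aut fix_A x y. rewrite <- (sat_auto_fixing A phi (scons x (env1 y)) aut fix_A HA).
  apply sat_eq_env. intros [| n]; reflexivity.
Qed.

Lemma stationarily_ordered_spec (A : M -> Prop) (p : mformula M -> Prop) :
  stationarily_ordered A p ->
  exists lt, linear_on (realizes p) lt /\ invariant_over A lt /\
    forall chi, fbound 1 chi ->
      decides_left (realizes p) lt chi /\ decides_left (realizes p) (flip lt) chi.
Proof.
  intros [delta [lambda [_ [_ [_ [lA [irr [tr [tot [sub dec]]]]]]]]]].
  set (lt := fun x y => sat (scons x (env1 y)) lambda) in *.
  assert (lin : linear_on (realizes p) lt).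
  { split; [| split].
    - intros x Px. apply irr, sub, Px.
    - intros x y z Px Py Pz. apply tr; apply sub; assumption.
    - intros x y Px Py. apply tot; apply sub; assumption. }
  exists lt. split; [exact lin |]. split; [apply formula_invariant, lA |].
  intros chi Hchi. destruct (dec chi Hchi) as [I F].
  assert (go : forall (X : M -> Prop) R, linear_on (realizes p) R ->
    (exists S, initial_segment M (realizes p) R S /\ subset M S X) -> holds_left (realizes p) R X).
  { intros X R [_ [_ totR]] [S [[SP [[s Ss] down]] SX]]. exists s. split; [apply SP, Ss |].
    intros x Px nlt. apply SX. destruct (classic (x = s)) as [-> | ne]; [exact Ss |].
    destruct (totR x s Px (SP s Ss) ne) as [H | H]; [| tauto]. exact (down s x Ss Px H). }
  split.
  - destruct I as [I | I]; [left | right]; apply go; assumption.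
  - destruct F as [F | F]; [left | right]; exact (go _ _ (linear_on_flip lin) F).
Qed.

(** * Two invariant orders on the locus of one type *)

Section OneType.
Variables (A : M -> Prop) (p : mformula M -> Prop).
Hypotheses (small_A : small M K A) (complete_p : complete_1type A p).

(* All realizations of [p] are conjugate over [A], so the pair [v], [w] can be
   moved to make [w] any given point: every left part for [lt'] contains one
   for [lt]. *)
Lemma holds_left_transfer (lt lt' : M -> M -> Prop) (v w : M) (X : M -> Prop) :
  linear_on (realizes p) lt' -> invariant_over A lt -> invariant_over A lt' ->
  realizes p v -> realizes p w ->
  (forall x, realizes p x -> ~ lt' x w -> ~ lt x v) ->
  holds_left (realizes p) lt' X ->
  exists z, realizes p z /\ forall x, realizes p x -> lt x z -> X x.
Proof.
  intros [irr [tr _]] inv inv' pv pw H [u [pu Hu]].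
  destruct (automorphism_of_realizations mon small_A complete_p pw pu) as [s [aut [fix_A E]]].
  exists (s v). split; [apply (realizes_auto v complete_p aut fix_A), pv |].
  intros x px lx. apply Hu; [exact px |]. intros lux.
  destruct (automorphism_inverse aut) as [s' [aut' [s's ss']]].
  destruct (ex_intro (fun y => s y = x) (s' x) (ss' x)) as [y <-].
  rewrite <- E in lux. rewrite (realizes_auto y complete_p aut fix_A) in px.
  rewrite (inv s aut fix_A) in lx. rewrite (inv' s aut fix_A) in lux.
  apply (H y); [exact px | | exact lx]. intros lyw.
  apply (irr y px). exact (tr _ _ _ px pw px lyw lux).
Qed.

(** For the flipped order, [z] is the smaller of the two points; the last clause then puts the
    closed left part of [z] inside those of [x] and [y]. *)
Lemma exists_larger (lt : M -> M -> Prop) (x y : M) :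
  linear_on (realizes p) lt -> realizes p x -> realizes p y ->
  exists z, realizes p z /\ ~ lt z x /\ ~ lt z y /\
    forall t, realizes p t -> ~ lt t z -> ~ lt t x /\ ~ lt t y.
Proof.
  intros [irr [tr tot]] px py. destruct (classic (lt x y)) as [l | nl].
  - exists y. split; [exact py |]. split; [| split; [apply irr, py |]].
    + intros l'. exact (irr x px (tr _ _ _ px py px l l')).
    + intros t pt nt. split; [| exact nt]. intros l'. exact (nt (tr _ _ _ pt px py l' l)).
  - exists x. split; [exact px |]. split; [apply irr, px | split; [exact nl |]].
    intros t pt nt. split; [exact nt |]. intros l'.
    destruct (classic (x = y)) as [-> | ne]; [tauto |].
    destruct (tot x y px py ne) as [l'' | l'']; [tauto |].
    exact (nt (tr _ _ _ pt py px l' l'')).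
Qed.

(** Suppose [lt] becomes small at both ends of [lt']. Cutting at a point close to the right end of
    [lt'] leaves larger [lt]-values on the left, while cutting close to the left end leaves larger
    values on the right. All cut points are conjugate over [A], so they cannot behave
    differently. *)
Lemma not_small_at_both_ends (lt lt' : M -> M -> Prop) :
  linear_on (realizes p) lt -> linear_on (realizes p) lt' ->
  invariant_over A lt -> invariant_over A lt' ->
  ~ (forall v, realizes p v -> holds_left (realizes p) lt' (fun x => lt x v) /\
                               holds_left (realizes p) (flip lt') (fun x => lt x v)).
Proof.
  intros lin lin' inv inv' H.
  destruct (complete_realized mon small_A complete_p) as [x0 p0].
  (* [Psi x] says that the right part of [lt'] from [x] on is [lt]-cofinal over the left part up to
     [x]. *)
  set (Psi := fun x => forall x', realizes p x' -> ~ lt' x x' ->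
                exists y, realizes p y /\ ~ lt' y x /\ ~ lt y x').
  assert (Psi_const : forall x y, realizes p x -> realizes p y -> Psi x -> Psi y).
  { intros x y px py Hx. 
    destruct (automorphism_of_realizations mon small_A complete_p px py) as [s [aut [fix_A E]]].
    destruct (automorphism_inverse aut) as [s' [aut' [s's ss']]].
    intros y' py' n. destruct (ex_intro (fun z => s z = y') (s' y') (ss' y')) as [z <-].
    rewrite <- E, (inv' s aut fix_A) in n. rewrite (realizes_auto z complete_p aut fix_A) in py'.
    destruct (Hx z py' n) as [t [pt [n1 n2]]]. exists (s t). split; [| split].
    - apply (realizes_auto t complete_p aut fix_A), pt.
    - rewrite <- E, (inv' s aut fix_A). exact n1.
    - rewrite (inv s aut fix_A). exact n2. }
  destruct (H x0 p0) as [[u [pu Hu]] [w [pw Hw]]].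
  destruct (classic (Psi x0)) as [Y | N].
  (* [Psi] fails at the larger of [w] and [x0]: right of it all points are [lt]-below [x0], which
     lies on its left. *)
  - destruct (exists_larger lin' pw p0) as [y [py [_ [yx0 Hy]]]].
    destruct (Psi_const x0 y p0 py Y x0 p0 yx0) as [t [pt [n1 n2]]].
    apply n2, (Hw t pt). apply (Hy t pt n1).
  (* [Psi] holds at the smaller of [u] and [x0]: left of it all points are [lt]-below [x0], which
     lies on its right. *)
  - destruct (exists_larger (linear_on_flip lin') pu p0) as [x [px [_ [xx0 Hx]]]].
    apply N. apply (Psi_const x x0 px p0). intros x' px' n.
    exists x0. split; [exact p0 |]. split; [exact xx0 |]. intros l.
    destruct lin as [irr [tr _]]. apply (irr x0 p0). apply (tr x0 x' x0); auto.
    apply (Hu x' px'). apply (Hx x' px' n).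
Qed.

Hypothesis so_p : stationarily_ordered A p.

(** Each half-line below [v] is definable, hence decided at both ends of the witnessing order [lt'].
    If its complement contains one end, the half-line is bounded away from that end, and the
    decision of [chi] at the opposite end transfers to [lt]. Otherwise it contains both ends for
    every [v], against [not_small_at_both_ends]. *)
Lemma decided_below (lt : M -> M -> Prop) (chi : mformula M) :
  linear_on (realizes p) lt -> invariant_over A lt ->
  (forall v, realizes p v -> exists psi, fbound 1 psi /\ forall x, sat (env1 x) psi <-> lt x v) ->
  fbound 1 chi ->
  exists z, realizes p z /\
    ((forall x, realizes p x -> lt x z -> sat (env1 x) chi) \/
     (forall x, realizes p x -> lt x z -> ~ sat (env1 x) chi)).
Proof.
  intros lin inv def Hchi.
  destruct (stationarily_ordered_spec so_p) as [lt' [lin' [inv' dec]]].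
  apply NNPP. intros no.
  assert (step : forall R v, linear_on (realizes p) R -> invariant_over A R -> realizes p v ->
     decides_left (realizes p) R chi ->
     ~ holds_left (realizes p) (flip R) (fun x => ~ lt x v)).
  { intros R v linR invR pv [D | D] [w [pw Hw]];
    destruct (holds_left_transfer linR inv invR pv pw Hw D) as [z [pz Hz]];
    apply no; exists z; auto. }
  apply (not_small_at_both_ends lin lin' inv inv'). intros v pv.
  destruct (def v pv) as [psi [Hpsi E]]. destruct (dec psi Hpsi) as [D1 D2].
  assert (conv : forall R, decides_left (realizes p) R psi ->
     holds_left (realizes p) R (fun x => lt x v) \/ holds_left (realizes p) R (fun x => ~ lt x v)).
  { intros R [[u [pu Hu]] | [u [pu Hu]]]; [left | right]; exists u; split; try exact pu;
    intros x px n; specialize (Hu x px n); [apply E, Hu | rewrite <- E; exact Hu]. }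
  destruct (dec chi Hchi) as [C1 C2]. split.
  - destruct (conv _ D1) as [h | h]; [exact h | exfalso].
    exact (step (flip lt') v (linear_on_flip lin') (invariant_over_flip inv') pv C2 h).
  - destruct (conv _ D2) as [h | h]; [exact h | exfalso].
    exact (step lt' v lin' inv' pv C1 h).
Qed.

(** * The global type of the left end *)

Section LeftType.
Variable lt : M -> M -> Prop.
Hypotheses (lin : linear_on (realizes p) lt) (inv : invariant_over A lt)
  (dec : forall chi, fbound 1 chi -> decides_left (realizes p) lt chi).

(* [c] realizes the restriction to [N] of the global [A]-invariant type of the
   left end of [p]. *)
Definition left_generic (N : M -> Prop) (c : M) : Prop :=
  forall phi, fbound 1 phi -> params_in N phi ->
  holds_left (realizes p) lt (fun x => sat (env1 x) phi) -> sat (env1 c) phi.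

Lemma left_generic_exists (N : M -> Prop) : small M K N -> exists c, left_generic N c.
Proof.
  intros HN. destruct mon as [_ [_ [sat_ _]]].
  destruct (sat_ N (fun phi => (fbound 1 phi /\ params_in N phi) /\
      holds_left (realizes p) lt (fun x => sat (env1 x) phi)) HN) as [c Hc].
  - intros phi [H _]. exact H.
  - intros l Hl.
    assert (bot : exists u, realizes p u /\ forall phi, In phi l -> forall x, realizes p x -> ~ lt u x ->
               sat (env1 x) phi).
    { induction l as [| phi l IH].
      - destruct (complete_realized mon small_A complete_p) as [x px]. exists x.
        split; [exact px |]. intros phi [].
      - destruct IH as [u [pu Hu]]; [intros psi Hpsi; apply Hl; right; exact Hpsi |].
        destruct (proj2 (Hl phi (or_introl eq_refl))) as [u' [pu' Hu']].
        (* The smaller of [u] and [u'] gives a left part on which [phi] and all formulas treated so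
           far hold. *)
        destruct (exists_larger (linear_on_flip lin) pu pu') as [z [pz [_ [_ Hz]]]].
        exists z. split; [exact pz |].
        intros psi [<- | Hpsi] x px n; destruct (Hz x px n) as [n1 n2]; auto. }
    destruct bot as [u [pu Hu]]. exists u. intros phi Hphi. apply (Hu phi Hphi u pu), lin, pu.
  - exists c. intros phi H1 H2 H3. apply Hc. auto.
Qed.

Lemma left_generic_realizes (N : M -> Prop) (c : M) :
  (forall x, A x -> N x) -> left_generic N c -> realizes p c.
Proof.
  intros AN g phi Hphi. destruct complete_p as [pA _]. destruct (pA phi Hphi) as [H1 H2].
  apply g; [exact H1 | exact (params_in_mono _ _ phi AN H2) |].
  destruct (complete_realized mon small_A complete_p) as [u pu].
  exists u. split; [exact pu |]. intros x px _. apply px, Hphi.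
Qed.

Lemma left_generic_mono (N N' : M -> Prop) (c : M) :
  (forall x, N x -> N' x) -> left_generic N' c -> left_generic N c.
Proof. intros sub g phi H1 H2. apply g; [exact H1 | exact (params_in_mono _ _ phi sub H2)]. Qed.

Lemma left_generic_move (N : M -> Prop) (c : M) (s : M -> M) :
  automorphism M s -> (forall x, A x -> s x = x) ->
  left_generic N c -> left_generic (fun y => exists x, N x /\ s x = y) (s c).
Proof.
  intros aut fix_A g phi H1 H2 [u [pu Hu]].
  destruct (automorphism_inverse aut) as [s' [aut' [s's ss']]].
  assert (fix_A' : forall x, A x -> s' x = x).
  { intros x Ax. rewrite <- (fix_A x Ax) at 1. apply s's. }
  assert (E : forall x, sat (env1 (s x)) phi <-> sat (env1 x) (fmove s' phi)).
  { intros x. rewrite <- (sat_fmove phi (env1 (s x)) aut'). apply sat_eq_env.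
    intros n. apply s's. }
  apply E. destruct (@fmove_ok L M s' (fun y => exists x, N x /\ s x = y) N 1 phi) as [H3 H4]; try assumption.
  - intros y [x [Nx <-]]. rewrite s's. exact Nx.
  - apply g; [exact H3 | exact H4 |]. exists (s' u). split.
    + apply (realizes_auto u complete_p aut' fix_A'), pu.
    + intros x px n. apply E, Hu; [apply (realizes_auto x complete_p aut fix_A), px |].
      rewrite <- (ss' u). rewrite (inv aut fix_A). exact n.
Qed.

(** Since every formula is decided at the left end, the left type is complete over [N], so its
    realizations are conjugate over [N]. *)
Lemma left_generic_conjugate (N : M -> Prop) (c d : M) :
  small M K N -> left_generic N c -> left_generic N d ->
  exists s, automorphism M s /\ (forall x, N x -> s x = x) /\ s c = d.
Proof.
  intros HN gc gd. apply (automorphism_of_types mon); [exact HN |].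
  intros phi H1 H2 Hc. destruct (dec phi H1) as [D | D].
  - exact (gd phi H1 H2 D).
  - exfalso. exact (gc (fneg phi) H1 H2 D Hc).
Qed.
End LeftType.

Lemma elementary_substructure_move (N : M -> Prop) (s : M -> M) :
  automorphism M s -> elementary_substructure M N ->
  elementary_substructure M (fun y => exists x, N x /\ s x = y).
Proof.
  intros aut [[x Nx] el]. destruct (automorphism_inverse aut) as [s' [aut' [s's ss']]].
  split; [exists (s x), x; auto |]. intros phi H1 H2 [y Hy].
  assert (E : forall x, sat (env1 (s x)) phi <-> sat (env1 x) (fmove s' phi)).
  { intros z. rewrite <- (sat_fmove phi (env1 (s z)) aut'). apply sat_eq_env.
    intros n. apply s's. }
  destruct (@fmove_ok L M s' (fun y => exists x, N x /\ s x = y) N 1 phi) as [H3 H4]; try assumption.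
  - intros z [t [Nt <-]]. rewrite s's. exact Nt.
  - destruct (el _ H3 H4) as [z [Nz Hz]].
    + exists (s' y). apply E. rewrite ss'. exact Hy.
    + exists (s z). split; [exists z; auto | apply E, Hz].
Qed.

Lemma realizations_same_lstp (a b : M) :
  realizes p a -> realizes p b -> exists s, Autf M K A s /\ s a = b.
Proof.
  intros pa pb.
  destruct (stationarily_ordered_spec so_p) as [lt [lin [inv dec]]].
  assert (dec1 : forall chi, fbound 1 chi -> decides_left (realizes p) lt chi).
  { intros chi H. apply dec, H. }
  destruct (small_elementary_superset mon small_A) as [N [HN [el AN]]].
  destruct (left_generic_exists lin HN) as [c gc].
  assert (pc := left_generic_realizes AN gc).
  (* The model is obtained by conjugating: an automorphism over [A] taking [c] to [x] carries [N] to
     a model over which [x] is generic. *)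
  assert (model : forall x, realizes p x -> exists N', small M K N' /\ elementary_substructure M N' /\
            (forall y, A y -> N' y) /\ left_generic lt N' x).
  { intros x px.
    destruct (automorphism_of_realizations mon small_A complete_p pc px) as [s [aut [fix_A E]]].
    exists (fun y => exists x, N x /\ s x = y). split; [| split; [| split]].
    - apply small_sub with (2 := small_surj M (fun z : {x | N x} => s (proj1_sig z)) HN).
      intros y [z [Nz <-]]. exists (exist _ z Nz). reflexivity.
    - apply elementary_substructure_move; assumption.
    - intros y Ay. exists y. split; [apply AN, Ay | apply fix_A, Ay].
    - rewrite <- E. apply left_generic_move; assumption. }
  destruct (model a pa) as [Na [Ha [ela [ANa ga]]]].
  destruct (model b pb) as [Nb [Hb [elb [ANb gb]]]].
  destruct (left_generic_exists lin (small_union mon Ha Hb)) as [d gd].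
  assert (gda : left_generic lt Na d) by (revert gd; apply left_generic_mono; auto).
  assert (gdb : left_generic lt Nb d) by (revert gd; apply left_generic_mono; auto).
  destruct (left_generic_conjugate dec1 Ha ga gda) as [s1 [aut1 [fix1 E1]]].
  destruct (left_generic_conjugate dec1 Hb gdb gb) as [s2 [aut2 [fix2 E2]]].
  exists (fun x => s2 (s1 x)). split; [| congruence].
  exists [s2; s1]. split; [| reflexivity].
  intros t [<- | [<- | []]]; (split; [assumption |]); eauto.
Qed.
End OneType.

Lemma Autf_id (A : M -> Prop) : Autf M K A (fun x => x).
Proof. exists []. split; [intros t [] | reflexivity]. Qed.

Lemma compose_all_app (l l' : list (M -> M)) (x : M) :
  compose_all M (l ++ l') x = compose_all M l (compose_all M l' x).
Proof. induction l as [| s l IH]; cbn; [reflexivity | rewrite IH; reflexivity]. Qed.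

Lemma Autf_compose (A : M -> Prop) (s t : M -> M) :
  Autf M K A s -> Autf M K A t -> Autf M K A (fun x => s (t x)).
Proof.
  intros [l [Hl El]] [l' [Hl' El']]. exists (l ++ l'). split.
  - intros u Hu. apply in_app_or in Hu. destruct Hu; auto.
  - intros x. rewrite compose_all_app, El, El'. reflexivity.
Qed.

Lemma Autf_mono (A B : M -> Prop) (s : M -> M) :
  (forall x, A x -> B x) -> Autf M K B s -> Autf M K A s.
Proof.
  intros AB [l [Hl El]]. exists l. split; [| exact El]. intros t Ht.
  destruct (Hl t Ht) as [aut [N [H1 [H2 [H3 H4]]]]]. split; [exact aut |].
  exists N. split; [exact H1 | split; [exact H2 | split; [| exact H4]]].
  intros x Ax. apply H3, AB, Ax.
Qed.

Lemma Autf_automorphism (A : M -> Prop) (s : M -> M) :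
  Autf M K A s -> automorphism M s /\ forall x, A x -> s x = x.
Proof.
  intros [l [Hl El]]. apply functional_extensionality in El. subst s.
  induction l as [| s l IH]; [split; [apply automorphism_id | reflexivity] |].
  destruct IH as [aut fix_A]; [intros t Ht; apply Hl; right; exact Ht |].
  destruct (Hl s (or_introl eq_refl)) as [aut' [N [_ [_ [AN fix_N]]]]]. split.
  - exact (automorphism_compose aut' aut).
  - intros x Ax. cbn. rewrite fix_A by exact Ax. auto.
Qed.

Hypothesis all_so : forall (A : M -> Prop) (p : mformula M -> Prop),
  small M K A -> complete_1type A p -> stationarily_ordered A p.

(** The last coordinate is matched first and then joins the base, so that the strong automorphism
    for the other coordinates fixes it; hence [A] varies in the induction. *)
Lemma same_type_same_lstp (n : nat) : forall (A : M -> Prop) (a b : nat -> M),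
  small M K A -> same_type M A n a b -> same_lstp M K A n a b.
Proof.
  induction n as [| n IH]; intros A a b HA ab.
  - exists (fun x => x). split; [apply Autf_id | intros i lt; lia].
  - assert (pb : realizes (one_type A (a n)) (b n)).
    { intros phi [H1 [H2 H3]].
      destruct (@fsub_ok L M M A A phi 1 (S n) (fun _ => inl n) (fun x => inr x)) as [H4 H5];
        cbn; auto.
      apply (sat_sub_vars (fun _ => inl n) phi b), (ab _ H4 H5), sat_sub_vars. exact H3. }
    destruct (realizations_same_lstp HA (one_type_complete M A (a n))
      (all_so HA (one_type_complete M A (a n))) (@realizes_one_type L M A (a n)) pb) as [s [Hs E]].
    destruct (Autf_automorphism Hs) as [aut fix_A].
    destruct (IH (fun x => A x \/ x = b n) (fun i => s (a i)) b) as [t [Ht Et]].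
    + apply small_add; assumption.
    + intros phi H1 H2.
      (* The parameter [b n] is turned into the variable [n], which has the value [b n] in both
         environments; this leaves a formula over [A] in [S n] variables. *)
      set (w := fun x => if excluded_middle_informative (x = b n) then inl n else inr x : nat + M).
      destruct (@fsub_ok L M M (fun x => A x \/ x = b n) A phi n (S n) (fun i => inl i) w) as [H3 H4]; auto.
      { intros i lt. cbn. lia. }
      { intros x Hx. unfold w. destruct excluded_middle_informative; cbn; [lia | tauto]. }
      assert (Ew : forall e : nat -> M, e n = b n -> sat e (fsub (fun i => inl i) w phi) <-> sat e phi).
      { intros e He. rewrite sat_sub, <- (gsat_id phi e).
        apply gsat_ext with (A := fun _ => True) (k := n); auto using params_in_full.
        intros x _. unfold w. destruct excluded_middle_informative as [-> |]; [exact He | reflexivity]. }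
      rewrite <- (Ew b eq_refl), <- (Ew (fun i => s (a i)) E).
      rewrite (sat_auto_fixing A _ a aut fix_A H4). apply ab; assumption.
    + exists (fun x => t (s x)). split.
      * apply Autf_compose; [| exact Hs]. revert Ht. apply Autf_mono. auto.
      * intros i lt. destruct (Nat.eq_dec i n) as [-> | ne].
        -- rewrite E. apply (Autf_automorphism Ht). auto.
        -- apply Et. lia.
Qed.
End StationarilyOrdered.

(** * Iterated ultrafilter quantifiers *)

Section UltrafilterQuantifier.
Variable U : (nat -> Prop) -> Prop.
Hypotheses (U_mono : forall X Y : nat -> Prop, (forall k, X k -> Y k) -> U X -> U Y)
  (U_and : forall X Y : nat -> Prop, U X -> U Y -> U (fun k => X k /\ Y k))
  (U_em : forall X : nat -> Prop, U X \/ U (fun k => ~ X k))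
  (U_ge : forall n, U (fun k => n <= k))
  (U_ex : forall X : nat -> Prop, U X -> exists k, X k).

(* The quantifier "for [U]-almost all k_0, ..., for [U]-almost all k_(n-1)". *)
Fixpoint ultra (n : nat) (F : (nat -> nat) -> Prop) : Prop :=
  match n with
  | 0 => F (fun _ => 0)
  | S n => U (fun k => ultra n (fun f => F (scons k f)))
  end.

Lemma ultra_mono (n : nat) : forall F G : (nat -> nat) -> Prop,
  (forall f, F f -> G f) -> ultra n F -> ultra n G.
Proof.
  induction n as [| n IH]; cbn; intros F G FG; [apply FG |].
  apply U_mono. intros k. apply IH. intros f. apply FG.
Qed.

Lemma ultra_iff (n : nat) (F G : (nat -> nat) -> Prop) :
  (forall f, F f <-> G f) -> ultra n F <-> ultra n G.
Proof. intros FG. split; apply ultra_mono; apply FG. Qed.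

Lemma ultra_and (n : nat) : forall F G : (nat -> nat) -> Prop,
  ultra n F -> ultra n G -> ultra n (fun f => F f /\ G f).
Proof.
  induction n as [| n IH]; cbn; intros F G; [auto |].
  intros HF HG. apply (U_mono (X := fun k => ultra n (fun f => F (scons k f)) /\ ultra n (fun f => G (scons k f)))).
  - intros k [H1 H2]. apply (IH _ _ H1 H2).
  - apply U_and; assumption.
Qed.

Lemma ultra_em (n : nat) : forall F : (nat -> nat) -> Prop, ultra n F \/ ultra n (fun f => ~ F f).
Proof.
  induction n as [| n IH]; cbn; intros F; [apply classic |].
  destruct (U_em (fun k => ultra n (fun f => F (scons k f)))) as [H | H]; [auto |].
  right. revert H. apply U_mono. intros k H. destruct (IH (fun f => F (scons k f))); tauto.
Qed.

Lemma ultra_ex (n : nat) : forall F : (nat -> nat) -> Prop, ultra n F -> exists f, F f.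
Proof.
  induction n as [| n IH]; cbn; intros F H; [eauto |].
  destruct (U_ex H) as [k Hk]. destruct (IH _ Hk) as [f Hf]. eauto.
Qed.

Lemma ultra_all (n : nat) : forall F : (nat -> nat) -> Prop, (forall f, F f) -> ultra n F.
Proof.
  induction n as [| n IH]; cbn; intros F H; [apply H |].
  apply U_mono with (2 := U_ge 0). intros k _. apply IH. auto.
Qed.

Lemma ultra_const (n : nat) (C : Prop) : ultra n (fun _ => C) <-> C.
Proof.
  split; [intros H; destruct (ultra_ex n _ H); assumption | intros H; apply ultra_all; auto].
Qed.

Definition increasing_below (n : nat) (f : nat -> nat) : Prop :=
  forall i j, i < j -> j < n -> f i < f j.

Lemma ultra_above (k n : nat) : ultra n (fun f => forall i, i < n -> k < f i).
Proof.
  induction n as [| n IH]; cbn; [intros i lt; lia |].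
  apply U_mono with (2 := U_ge (S k)). intros k' le. revert IH. apply ultra_mono.
  intros f Hf [| i] lt; cbn; [lia | apply Hf; lia].
Qed.

Lemma ultra_increasing (n : nat) : ultra n (increasing_below n).
Proof.
  induction n as [| n IH]; cbn; [intros i j lt lt'; lia |].
  apply U_mono with (2 := U_ge 0). intros k _.
  apply (ultra_mono n) with (2 := ultra_and n _ _ IH (ultra_above k n)).
  intros f [H1 H2] i [| j] lt lt'; [lia |]. destruct i as [| i]; cbn; [apply H2 | apply H1]; lia.
Qed.

Definition increasing (f : nat -> nat) : Prop := forall i j, i < j -> f i < f j.

(** Quantifiers over positions that [rho] skips act on a proposition not depending on them and
    disappear. This is the source of indiscernibility. *)
Lemma ultra_reindex (n' : nat) : forall (n : nat) (rho : nat -> nat) (F : (nat -> nat) -> Prop),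
  increasing rho -> (forall i, i < n -> rho i < n') ->
  (forall f g, (forall i, i < n -> f i = g i) -> F f <-> F g) ->
  ultra n' (fun f => F (fun i => f (rho i))) <-> ultra n F.
Proof.
  induction n' as [| n' IH]; intros n rho F incr bound ext.
  - destruct n as [| n]; [reflexivity |]. specialize (bound 0). lia.
  - destruct n as [| n].
    + rewrite <- (ultra_const (S n') (ultra 0 F)). apply ultra_iff.
      intros f. apply ext. intros i lt. lia.
    + assert (pos : forall i, 0 < rho (S i)) by (intros i; specialize (incr 0 (S i)); lia).
      destruct (rho 0) as [| r0] eqn:E0.
      * assert (E : forall k, ultra n' (fun f => F (fun i => scons k f (rho i))) <->
                              ultra n (fun f => F (scons k f))).
        { intros k. rewrite <- (IH n (fun i => pred (rho (S i))) (fun f => F (scons k f))).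
          - apply ultra_iff. intros f. apply ext. intros [| i] lt; cbn; [rewrite E0; reflexivity |].
            specialize (pos i). destruct (rho (S i)); [lia | reflexivity].
          - intros i j lt. specialize (incr (S i) (S j)). specialize (pos i). lia.
          - intros i lt. specialize (bound (S i)). specialize (pos i). lia.
          - intros f g fg. apply ext. intros [| i] lt; cbn; [reflexivity | apply fg; lia]. }
        cbn. split; apply U_mono; intros k; apply E.
      (* Here [rho] skips position 0, so the outermost quantifier is vacuous; in the previous case
         it binds the first argument of [F]. *)
      * assert (pos' : forall i, 0 < rho i) by (intros [| i]; [lia | apply pos]).
        assert (E : forall k, ultra n' (fun f => F (fun i => scons k f (rho i))) <-> ultra (S n) F).
        { intros k. rewrite <- (IH (S n) (fun i => pred (rho i)) F).
          - apply ultra_iff. intros f. apply ext. intros i lt.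
            specialize (pos' i). destruct (rho i); [lia | reflexivity].
          - intros i j lt. specialize (incr i j). specialize (pos' i). lia.
          - intros i lt. specialize (bound i). specialize (pos' i). lia.
          - exact ext. }
        rewrite <- (ultra_const 1 (ultra (S n) F)).
        change (U (fun k => ultra n' (fun f => F (fun i => scons k f (rho i)))) <->
                U (fun _ => ultra (S n) F)).
        split; apply U_mono; intros k; apply E.
Qed.

(** All row indices are chosen before all column indices. With two separate blocks, rows and columns
    can be reindexed independently. *)
Definition ultra2 (n : nat) (F : (nat -> nat) -> (nat -> nat) -> Prop) : Prop :=
  ultra n (fun f => ultra n (fun g => F f g)).

Lemma ultra2_mono (n : nat) (F G : (nat -> nat) -> (nat -> nat) -> Prop) :
  (forall f g, F f g -> G f g) -> ultra2 n F -> ultra2 n G.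
Proof. intros FG. apply ultra_mono. intros f. apply ultra_mono. apply FG. Qed.

Lemma ultra2_and (n : nat) (F G : (nat -> nat) -> (nat -> nat) -> Prop) :
  ultra2 n F -> ultra2 n G -> ultra2 n (fun f g => F f g /\ G f g).
Proof.
  intros HF HG. apply (ultra_mono n) with (2 := ultra_and n _ _ HF HG).
  intros f [H1 H2]. apply ultra_and; assumption.
Qed.

Lemma ultra2_em (n : nat) (F : (nat -> nat) -> (nat -> nat) -> Prop) :
  ultra2 n F \/ ultra2 n (fun f g => ~ F f g).
Proof.
  destruct (ultra_em n (fun f => ultra n (fun g => F f g))) as [H | H]; [left; exact H | right].
  revert H. apply ultra_mono. intros f H. destruct (ultra_em n (fun g => F f g)); tauto.
Qed.

Lemma ultra2_ex (n : nat) (F : (nat -> nat) -> (nat -> nat) -> Prop) :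
  ultra2 n F -> exists f g, F f g.
Proof.
  intros H. destruct (ultra_ex n _ H) as [f Hf]. destruct (ultra_ex n _ Hf) as [g Hg]. eauto.
Qed.

Lemma ultra2_increasing (n : nat) (F : (nat -> nat) -> (nat -> nat) -> Prop) :
  (forall f g, increasing_below n f -> increasing_below n g -> F f g) -> ultra2 n F.
Proof.
  intros H. apply (ultra_mono n) with (2 := ultra_increasing n). intros f Hf.
  apply (ultra_mono n) with (2 := ultra_increasing n). auto.
Qed.

Lemma ultra2_reindex (n n' : nat) (rho tau : nat -> nat)
  (F : (nat -> nat) -> (nat -> nat) -> Prop) :
  increasing rho -> increasing tau ->
  (forall i, i < n -> rho i < n') -> (forall i, i < n -> tau i < n') ->
  (forall f f' g g', (forall i, i < n -> f i = f' i) -> (forall i, i < n -> g i = g' i) ->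
     F f g <-> F f' g') ->
  ultra2 n' (fun f g => F (fun i => f (rho i)) (fun i => g (tau i))) <-> ultra2 n F.
Proof.
  intros Hr Ht br bt ext. unfold ultra2.
  rewrite <- (@ultra_reindex n' n rho (fun f => ultra n (fun g => F f g)) Hr br).
  - apply ultra_iff. intros f.
    apply (@ultra_reindex n' n tau (fun g => F (fun i => f (rho i)) g) Ht bt).
    intros g g' E. apply ext; auto.
  - intros f f' E. apply ultra_iff. intros g. apply ext; auto.
Qed.
End UltrafilterQuantifier.

Lemma nonprincipal_ultrafilter : exists U : (nat -> Prop) -> Prop,
  (forall X Y : nat -> Prop, (forall k, X k -> Y k) -> U X -> U Y) /\
  (forall X Y : nat -> Prop, U X -> U Y -> U (fun k => X k /\ Y k)) /\
  (forall X : nat -> Prop, U X \/ U (fun k => ~ X k)) /\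
  (forall n, U (fun k => n <= k)) /\
  (forall X : nat -> Prop, U X -> exists k, X k).
Proof.
  destruct (@filter.ultraFilterLemma nat (fun X => exists n, forall k, n <= k -> X k)) as [U [HU sub]].
  - apply filter.Build_ProperFilter_ex.
    + intros X [n Hn]. exists n. apply Hn. lia.
    + split.
      * exists 0. intros k _. exact I.
      * intros X Y [n Hn] [m Hm]. exists (max n m). intros k le. split; [apply Hn | apply Hm]; lia.
      * intros X Y XY [n Hn]. exists n. intros k le. apply XY, Hn, le.
  - pose proof (@filter.ultra_proper _ _ HU) as PU.
    exists U. split; [| split; [| split; [| split]]].
    + intros X Y XY. apply filter.filterS. exact XY.
    + intros X Y. apply filter.filterI.
    + intros X. exact (filter.in_ultra_setVsetC X HU).
    + intros n. apply sub. exists n. auto.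
    + intros X. apply filter.filter_ex.
Qed.

(** * Indiscernible arrays *)

Section Compactness.
Variables (L : language) (M : structure L) (K : Type).
Hypothesis mon : monster M K.

Definition extends (l : list M) (e : nat -> M) : Prop :=
  forall i x, nth_error l i = Some x -> e i = x.

(** This puts a condition on all coordinates after [l] into a single formula about the next one, to
    which one-variable saturation applies. *)
Lemma projection_formula (l : list M) (F : list (mformula M)) :
  (forall phi, In phi F -> parameter_free phi) ->
  exists chi, fbound 1 chi /\ params_in (fun x => In x l) chi /\
    forall x, sat (env1 x) chi <->
      exists e, extends l e /\ e (length l) = x /\ forall phi, In phi F -> sat e phi.
Proof.
  intros pf. set (n := length l).
  destruct (fbound_exists (fconj F)) as [N HN].
  (* Positions in [l] become parameters, position [n] becomes the variable [N], and later positions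
     become variables for the [N] quantifiers. Under these quantifiers, [N] is the free variable
     0. *)
  set (v := fun i => match nth_error l i with
                     | Some y => inr y
                     | None => if i =? n then inl N else inl (i - n - 1) end).
  destruct (@fsub_ok L M M (fun _ => False) (fun x => In x l) (fconj F) N (N + 1) v (fun x => inr x))
    as [H1 H2].
  - intros i lt. unfold v. destruct (nth_error l i) as [y |] eqn:E; cbn.
    + apply nth_error_In in E. exact E.
    + destruct (i =? n); cbn; lia.
  - intros x [].
  - exact HN.
  - apply fconj_params, pf.
  - exists (fexn N (fsub v (fun x => inr x) (fconj F))).
    split; [apply fexn_bound, H1 | split; [apply fexn_params, H2 |]].
    intros x. rewrite sat_fexn. split.
    + intros [d H]. apply sat_sub_vars in H.
      exists (fun i => atom_val M (fun x => x) (fun i => if i <? N then d i else env1 x (i - N)) (v i)).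
      split; [| split].
      * intros i y E. unfold v. rewrite E. reflexivity.
      * unfold v. rewrite (proj2 (nth_error_None l n) (le_n _)), Nat.eqb_refl. cbn [atom_val]. rewrite Nat.ltb_irrefl. reflexivity.
      * apply sat_fconj, H.
    + intros [e [ext [En H]]]. exists (fun j => e (j + n + 1)). apply sat_sub_vars.
      apply sat_fconj in H. revert H. apply sat_ext with (k := N); [exact HN |].
      intros i lt. unfold v. destruct (nth_error l i) as [y |] eqn:E; cbn [atom_val].
      * symmetry. apply ext, E.
      * apply nth_error_None in E. fold n in E.
        destruct (Nat.eqb_spec i n) as [-> | ne]; cbn [atom_val].
        -- rewrite Nat.ltb_irrefl. symmetry. exact En.
        -- destruct (Nat.ltb_spec (i - n - 1) N); [| lia]. f_equal. lia.
Qed.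

(** The coordinates are chosen one at a time by saturation over the finitely many previous ones.
    Each formula involves only finitely many coordinates, so finite stages suffice to verify it. *)
Lemma countable_compactness (Sigma : mformula M -> Prop) :
  (forall phi, Sigma phi -> parameter_free phi) ->
  (forall F, (forall phi, In phi F -> Sigma phi) ->
     exists e : nat -> M, forall phi, In phi F -> sat e phi) ->
  exists e : nat -> M, forall phi, Sigma phi -> sat e phi.
Proof.
  intros pf fin.
  set (good := fun l => forall F, (forall phi, In phi F -> Sigma phi) ->
     exists e : nat -> M, extends l e /\ forall phi, In phi F -> sat e phi).
  assert (step : forall l, good l -> exists x, good (l ++ [x])).
  { intros l Hl. destruct mon as [_ [_ [sat_ _]]].
    destruct (sat_ (fun x => In x l) (fun chi => (fbound 1 chi /\ params_in (fun x => In x l) chi) /\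
       exists F, (forall phi, In phi F -> Sigma phi) /\ forall x, sat (env1 x) chi <->
         exists e, extends l e /\ e (length l) = x /\ forall phi, In phi F -> sat e phi))
      as [x Hx].
    - apply (small_list mon).
    - intros chi [H _]. exact H.
    - intros G HG.
      assert (all : exists F, (forall phi, In phi F -> Sigma phi) /\ forall e, extends l e ->
                (forall phi, In phi F -> sat e phi) -> 
                forall chi, In chi G -> sat (env1 (e (length l))) chi).
      { induction G as [| chi G IH].
        - exists []. split; [intros phi [] | intros e _ _ chi []].
        - destruct IH as [F [HF H]]; [intros psi Hpsi; apply HG; right; exact Hpsi |].
          destruct (HG chi (or_introl eq_refl)) as [_ [F' [HF' H']]].
          exists (F ++ F'). split.
          + intros phi Hphi. apply in_app_or in Hphi. destruct Hphi; auto.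
          + intros e ext He psi [<- | Hpsi].
            * apply H'. exists e. split; [exact ext | split; [reflexivity |]].
              intros phi Hphi. apply He, in_or_app. right. exact Hphi.
            * apply H; [exact ext | | exact Hpsi].
              intros phi Hphi. apply He, in_or_app. left. exact Hphi. }
      destruct all as [F [HF H]]. destruct (Hl F HF) as [e [ext He]].
      exists (e (length l)). exact (H e ext He).
    - exists x. intros F HF.
      destruct (@projection_formula l F) as [chi [H1 [H2 E]]]; [auto |].
      assert (Hchi : sat (env1 x) chi) by (apply Hx; eauto).
      apply E in Hchi. destruct Hchi as [e [ext [En He]]]. exists e. split; [| exact He].
      intros i y Hy. destruct (Nat.lt_ge_cases i (length l)) as [lt | le].
      + rewrite nth_error_app1 in Hy by exact lt. apply ext, Hy.
      + rewrite nth_error_app2 in Hy by exact le.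
        destruct (i - length l) as [| k] eqn:Ei; [| destruct k; discriminate].
        injection Hy as <-. replace i with (length l) by lia. exact En. }
  destruct (carrier_inhabited M) as [m].
  set (pick := fun l => epsilon (inhabits m) (fun x => good (l ++ [x]))).
  set (g := fix g n := match n with 0 => [] | S n => g n ++ [pick (g n)] end).
  assert (g_good : forall n, good (g n)).
  { induction n as [| n IH].
    - intros F HF. destruct (fin F HF) as [e He]. exists e. split; [| exact He].
      intros [| i] x; discriminate.
    - exact (epsilon_spec (inhabits m) (fun x => good (g n ++ [x])) (step _ IH)). }
  assert (g_len : forall n, length (g n) = n).
  { induction n as [| n IH]; [reflexivity |]. cbn. rewrite length_app, IH. cbn. lia. }
  assert (g_nth : forall n i, i < n -> nth_error (g n) i = Some (pick (g i))).
  { induction n as [| n IH]; intros i lt; [lia |]. cbn.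
    destruct (Nat.eq_dec i n) as [-> | ne].
    - rewrite nth_error_app2 by (rewrite g_len; lia). rewrite g_len, Nat.sub_diag. reflexivity.
    - rewrite nth_error_app1 by (rewrite g_len; lia). apply IH. lia. }
  exists (fun n => pick (g n)). intros phi Hphi.
  destruct (fbound_exists phi) as [N HN].
  destruct (g_good N [phi]) as [e [ext He]].
  - intros psi [<- | []]. exact Hphi.
  - specialize (He phi (or_introl eq_refl)). revert He. apply sat_ext with (k := N); [exact HN |].
    intros n lt. symmetry. apply ext, g_nth, lt.
Qed.

Definition indiscernible_array (A : nat -> nat -> M) : Prop :=
  forall (phi : mformula M) (g h rho tau : nat -> nat),
  parameter_free phi -> increasing rho -> increasing tau ->
  sat (fun v => A (rho (g v)) (tau (h v))) phi <-> sat (fun v => A (g v) (h v)) phi.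

Lemma indiscernible_array_transpose (A : nat -> nat -> M) :
  indiscernible_array A -> indiscernible_array (fun r s => A s r).
Proof. intros H phi g h rho tau pf Hr Ht. apply (H phi h g tau rho); assumption. Qed.

Section LimitArray.
Variables (a : nat -> nat -> M) (b c : nat -> nat -> M).

(* A variable codes a pair: [(0, u)] is the [u]-th entry of a tuple [b], [(1, u)]
   the [u]-th entry of a tuple [c], and [(r + 2, s)] the array entry in row [r]
   and column [s]. *)
Definition array_env (f g : nat -> nat) (v : nat) : M :=
  match Cantor.of_nat v with
  | (0, u) => b (f 0) u
  | (1, u) => c (g 0) u
  | (S (S r), s) => a (f r) (g s)
  end.

(** The Cantor code of a pair is at least the sum of its components, so variables below [n] meet
    only indices below [n]. Positivity of [n] covers [f 0] and [g 0], at which the tuples [b] and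
    [c] are taken. *)
Lemma array_env_ext (n : nat) (phi : mformula M) (f f' g g' : nat -> nat) :
  0 < n -> fbound n phi -> (forall i, i < n -> f i = f' i) -> (forall i, i < n -> g i = g' i) ->
  sat (array_env f g) phi <-> sat (array_env f' g') phi.
Proof.
  intros pos Hn Ef Eg. apply sat_ext with (k := n); [exact Hn |]. intros v lt. unfold array_env.
  destruct (Cantor.of_nat v) as [x y] eqn:E.
  assert (le : y + x <= v).
  { rewrite <- (Cantor.cancel_to_of v), E. apply Cantor.to_nat_non_decreasing. }
  destruct x as [| [| r]].
  - rewrite Ef by exact pos. reflexivity.
  - rewrite Eg by exact pos. reflexivity.
  - rewrite Ef, Eg by lia. reflexivity.
Qed.

Lemma bounded_below (g : nat -> nat) (k : nat) : exists m, forall v, v < k -> g v < m.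
Proof.
  induction k as [| k [m Hm]]; [exists 0; lia |].
  exists (S (max m (g k))). intros v lt. destruct (Nat.eq_dec v k) as [-> | ne]; [lia |].
  specialize (Hm v). lia.
Qed.

(** The array is realized together with one tuple [b] and one tuple [c], taken at the same limit
    index as row 0 and column 0. This is why row 0 and column 0 are singled out. *)
Lemma indiscernible_extraction (phi psi : mformula M) :
  parameter_free phi -> parameter_free psi ->
  (forall i k j, sat (scons (a i j) (b k)) phi <-> k = i) ->
  (forall i j k, sat (scons (a i j) (c k)) psi <-> k = j) ->
  exists (A : nat -> nat -> M) (b' c' : nat -> M), indiscernible_array A /\
    (forall r s, sat (scons (A r s) b') phi <-> r = 0) /\
    (forall r s, sat (scons (A r s) c') psi <-> s = 0).
Proof.
  intros pf_phi pf_psi Hphi Hpsi.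
  destruct nonprincipal_ultrafilter as [U [Um [Ua [Uem [Uge Uex]]]]].
  set (limit := fun n chi => ultra2 U n (fun f g => sat (array_env f g) chi)).
  assert (raise : forall n n' chi, 0 < n -> n <= n' -> fbound n chi -> limit n chi -> limit n' chi).
  { intros n n' chi pos le Hn H.
    apply (@ultra2_reindex U Um Uge Uex n n' (fun i => i) (fun i => i)
      (fun f g => sat (array_env f g) chi)); try (intros; lia); try (intros i j; auto; fail).
    - intros f f' g g' Ef Eg. apply array_env_ext with (n := n); assumption.
    - exact H. }
  set (Sigma := fun chi => parameter_free chi /\ exists n, 0 < n /\ fbound n chi /\ limit n chi).
  destruct (@countable_compactness Sigma) as [e He].
  { intros chi [H _]. exact H. }
  { intros F HF.
    assert (all : exists n0, forall n, n0 <= n ->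
              ultra2 U n (fun f g => forall chi, In chi F -> sat (array_env f g) chi)).
    { induction F as [| chi F IH].
      - exists 0. intros n _. apply (ultra2_increasing _ Um Ua Uge). intros f g _ _ chi [].
      - destruct IH as [n0 H0]; [intros theta Ht; apply HF; right; exact Ht |].
        destruct (HF chi (or_introl eq_refl)) as [_ [n1 [pos [Hn1 H1]]]].
        exists (max n0 n1). intros n le.
        apply (ultra2_mono _ Um n) with (2 := ultra2_and _ Um Ua n _ _ (H0 n ltac:(lia))
          (raise n1 n chi pos ltac:(lia) Hn1 H1)).
        intros f g [G1 G2] theta [<- | Ht]; auto. }
    destruct all as [n0 H0]. destruct (ultra2_ex _ Uex n0 _ (H0 n0 (le_n _))) as [f [g H]]. eauto. }
  (* The ultrafilter decides every formula, so [Sigma] is complete and [e] satisfies exactly the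
     limit truths. *)
  assert (Eq : forall chi n, parameter_free chi -> 0 < n -> fbound n chi ->
             sat e chi <-> limit n chi).
  { intros chi n pf pos Hn. split.
    - intros H. destruct (ultra2_em _ Um Uem n (fun f g => sat (array_env f g) chi)) as [H' | H'];
        [exact H' | exfalso].
      apply (He (fneg chi)); [| exact H]. split; [exact pf |]. exists n. auto.
    - intros H. apply He. split; [exact pf |]. exists n. auto. }
  assert (pf_ren : forall (v : nat -> nat) chi, parameter_free chi ->
             parameter_free (fsub (fun i => inl (v i)) (fun x => inr x) chi : mformula M)).
  { intros v chi pf. destruct (fbound_exists chi) as [k Hk]. destruct (bounded_below v k) as [m Hm].
    apply (@fsub_ok L M M (fun _ => False) (fun _ => False) chi k m); auto. }
  set (A := fun r s => e (Cantor.to_nat (S (S r), s))).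
  assert (env_A : forall f g r s, array_env f g (Cantor.to_nat (S (S r), s)) = a (f r) (g s)).
  { intros. unfold array_env. rewrite Cantor.cancel_of_to. reflexivity. }
  exists A, (fun u => e (Cantor.to_nat (0, u))), (fun u => e (Cantor.to_nat (1, u))).
  split; [| split].
  - intros chi g h rho tau pf Hr Ht.
    set (ren := fun rho tau : nat -> nat =>
      fsub (fun v => inl (Cantor.to_nat (S (S (rho (g v))), tau (h v)))) (fun x => inr x) chi : mformula M).
    assert (E : forall rho tau, sat (fun v => A (rho (g v)) (tau (h v))) chi <-> sat e (ren rho tau)).
    { intros. unfold ren. rewrite sat_sub_vars. reflexivity. }
    rewrite (E rho tau). rewrite (E (fun r => r) (fun s => s)).
    destruct (fbound_exists chi) as [k Hk].
    destruct (bounded_below g k) as [m1 Hm1]. destruct (bounded_below h k) as [m2 Hm2].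
    set (m := max m1 m2).
    set (F := fun f f' : nat -> nat => sat (fun v => a (f (g v)) (f' (h v))) chi).
    (* The right-hand side does not mention [rho] and [tau]: all increasing reindexings share one
       truth value, which is indiscernibility. *)
    assert (lim : forall rho tau, increasing rho -> increasing tau ->
              sat e (ren rho tau) <-> ultra2 U m F).
    { intros rho' tau' Hr' Ht'. destruct (fbound_exists (ren rho' tau')) as [n1 Hn1].
      set (n := S (max n1 (max (rho' m) (tau' m)))).
      rewrite (Eq (ren rho' tau') n); [| apply pf_ren, pf | lia | apply fbound_mono with (2 := Hn1); lia].
      rewrite <- (@ultra2_reindex U Um Uge Uex m n rho' tau' F Hr' Ht').
      - unfold limit. split; apply (ultra2_mono _ Um); intros f f'; unfold ren, F;
          rewrite sat_sub_vars; apply sat_eq_env; intros v; cbn [atom_val]; rewrite env_A; reflexivity.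
      - intros i lt. specialize (Hr' i m lt). lia.
      - intros i lt. specialize (Ht' i m lt). lia.
      - intros f f1 f' f1' E1 E2. unfold F. apply sat_ext with (k := k); [exact Hk |].
        intros v lt. specialize (Hm1 v lt). specialize (Hm2 v lt). rewrite E1, E2 by lia. reflexivity. }
    rewrite (lim rho tau Hr Ht). symmetry. apply lim; intros i j; auto.
  - intros r s.
    set (v := fun i => match i with 0 => Cantor.to_nat (S (S r), s) | S u => Cantor.to_nat (0, u) end).
    set (chi := fsub (fun i => inl (v i)) (fun x => inr x) phi : mformula M).
    assert (E : sat (scons (A r s) (fun u => e (Cantor.to_nat (0, u)))) phi <-> sat e chi).
    { unfold chi. rewrite sat_sub_vars. apply sat_eq_env. intros [| i]; reflexivity. }
    (* The entry lies in row [f r] and the tuple belongs to row [f 0]. For almost all choices [f] is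
       strictly increasing below the bound, so equality means [r = 0]. *)
    assert (Ef : forall f g, sat (array_env f g) chi <-> f 0 = f r).
    { intros f g. unfold chi. rewrite sat_sub_vars, <- (Hphi (f r) (f 0) (g s)).
      apply sat_eq_env. intros [| i]; [exact (env_A f g r s) |].
      unfold v. cbn [atom_val scons]. unfold array_env. rewrite Cantor.cancel_of_to. reflexivity. }
    assert (pf : parameter_free chi) by (apply pf_ren, pf_phi).
    rewrite E. destruct (fbound_exists chi) as [n1 Hn1]. split.
    + intros H. apply (Eq chi (S (max n1 r)) pf) in H; [| lia | apply fbound_mono with (2 := Hn1); lia].
      destruct (ultra2_ex _ Uex _ _ (ultra2_and _ Um Ua _ _ _ H (@ultra2_increasing _ Um Ua Uge (S (max n1 r))
        (fun f _ => increasing_below (S (max n1 r)) f) (fun f g Hf _ => Hf)))) as [f [g [H1 H2]]].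
      apply Ef in H1. destruct r as [| r]; [reflexivity |]. specialize (H2 0 (S r)). lia.
    + intros ->. apply (Eq chi (S n1) pf); [lia | apply fbound_mono with (2 := Hn1); lia |].
      apply (ultra2_increasing _ Um Ua Uge). intros f g _ _. apply Ef. reflexivity.
  - intros r s.
    set (v := fun i => match i with 0 => Cantor.to_nat (S (S r), s) | S u => Cantor.to_nat (1, u) end).
    set (chi := fsub (fun i => inl (v i)) (fun x => inr x) psi : mformula M).
    assert (E : sat (scons (A r s) (fun u => e (Cantor.to_nat (1, u)))) psi <-> sat e chi).
    { unfold chi. rewrite sat_sub_vars. apply sat_eq_env. intros [| i]; reflexivity. }
    assert (Eg : forall f g, sat (array_env f g) chi <-> g 0 = g s).
    { intros f g. unfold chi. rewrite sat_sub_vars, <- (Hpsi (f r) (g s) (g 0)).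
      apply sat_eq_env. intros [| i]; [exact (env_A f g r s) |].
      unfold v. cbn [atom_val scons]. unfold array_env. rewrite Cantor.cancel_of_to. reflexivity. }
    assert (pf : parameter_free chi) by (apply pf_ren, pf_psi).
    rewrite E. destruct (fbound_exists chi) as [n1 Hn1]. split.
    + intros H. apply (Eq chi (S (max n1 s)) pf) in H; [| lia | apply fbound_mono with (2 := Hn1); lia].
      destruct (ultra2_ex _ Uex _ _ (ultra2_and _ Um Ua _ _ _ H (@ultra2_increasing _ Um Ua Uge (S (max n1 s))
        (fun _ g => increasing_below (S (max n1 s)) g) (fun f g _ Hg => Hg)))) as [f [g [H1 H2]]].
      apply Eg in H1. destruct s as [| s]; [reflexivity |]. specialize (H2 0 (S s)). lia.
    + intros ->. apply (Eq chi (S n1) pf); [lia | apply fbound_mono with (2 := Hn1); lia |].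
      apply (ultra2_increasing _ Um Ua Uge). intros f g _ _. apply Eg. reflexivity.
Qed.
End LimitArray.
End Compactness.

(** * Dp-minimality *)

Section DpMinimality.
Variables (L : language) (M : structure L) (K : Type).
Hypothesis mon : monster M K.
Hypothesis all_so : forall (A : M -> Prop) (p : mformula M -> Prop),
  small M K A -> complete_1type A p -> stationarily_ordered A p.

Definition definable_over (B : M -> Prop) (X : M -> Prop) : Prop :=
  exists psi, fbound 1 psi /\ params_in B psi /\ forall x, sat (env1 x) psi <-> X x.

(** Definability of both half-lines keeps the notion stable under reversal: one half feeds
    [decided_below], the other places realizations of the limit type above the array. *)
Definition free_order (delta : mformula M) (lt : M -> M -> Prop) : Prop :=
  linear_on M (fun x => sat (env1 x) delta) lt /\ invariant_over M (fun _ => False) lt /\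
  (forall v, definable_over (fun x => x = v) (fun x => lt x v)) /\
  (forall v, definable_over (fun x => x = v) (fun x => lt v x)).

Lemma free_order_flip (delta : mformula M) (lt : M -> M -> Prop) :
  free_order delta lt -> free_order delta (flip M lt).
Proof.
  intros [lin [inv [d1 d2]]]. split; [apply linear_on_flip, lin |].
  split; [apply invariant_over_flip, inv | split; assumption].
Qed.

Lemma free_order_exists (x : M) : exists delta lambda,
  fbound 1 delta /\ parameter_free delta /\ sat (env1 x) delta /\
  fbound 2 lambda /\ parameter_free lambda /\
  free_order delta (fun x y => sat (scons x (env1 y)) lambda).
Proof.
  assert (sm : small M K (fun _ => False)) by (apply small_sub with (2 := small_list mon []); tauto).
  destruct (all_so sm (@one_type_complete L M _ x))
    as [delta [lambda [H1 [H2 [H3 [H4 [irr [tr [tot [sub _]]]]]]]]]].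
  exists delta, lambda. split; [exact H1 | split; [exact H2 |]].
  split; [apply sub, realizes_one_type |]. split; [exact H3 | split; [exact H4 |]].
  split; [split; [exact irr | split; [exact tr | exact tot]] |].
  split; [apply formula_invariant, H4 |].
  split; intros v.
  - set (t := fun n => match n with 0 => inl 0 | S _ => inr v end : nat + M).
    destruct (@fsub_ok L M M (fun _ => False) (fun x => x = v) lambda 2 1 t (fun x => inr x)) as [H5 H6];
      auto.
    + intros [| n] _; cbn; [lia | reflexivity].
    + intros p [].
    + exists (fsub t (fun x => inr x) lambda). split; [exact H5 | split; [exact H6 |]].
      intros y. rewrite sat_sub_vars. apply sat_eq_env. intros [| n]; reflexivity.
  - set (t := fun n => match n with 0 => inr v | S _ => inl 0 end : nat + M).
    destruct (@fsub_ok L M M (fun _ => False) (fun x => x = v) lambda 2 1 t (fun x => inr x)) as [H5 H6];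
      auto.
    + intros [| n] _; cbn; [reflexivity | lia].
    + intros p [].
    + exists (fsub t (fun x => inr x) lambda). split; [exact H5 | split; [exact H6 |]].
      intros y. rewrite sat_sub_vars. apply sat_eq_env. intros [| n]; reflexivity.
Qed.

Definition row_increasing (A : nat -> nat -> M) (lt : M -> M -> Prop) : Prop :=
  forall i i' j j', i < i' -> lt (A i j) (A i' j').

(** Beyond the rows of its finitely many parameters, [theta] cannot tell entries of columns 0 and 1
    apart: both columns lie on the same side of column 2. *)
Lemma eventual_truth (A : nat -> nat -> M) (theta : mformula M) :
  indiscernible_array M A -> fbound 1 theta -> params_in (fun x => exists k, A k 2 = x) theta ->
  exists N, forall i i' j j', N <= i -> N <= i' -> j < 2 -> j' < 2 ->
    sat (env1 (A i j)) theta -> sat (env1 (A i' j')) theta.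
Proof.
  intros ind H1 H2.
  set (idx := fun x => epsilon (inhabits 0) (fun k => A k 2 = x)).
  assert (Hidx : forall x, (exists k, A k 2 = x) -> A (idx x) 2 = x).
  { intros x. apply (epsilon_spec (inhabits 0) (fun k => A k 2 = x)). }
  (* The chain in [N] yields a common bound on the row indices of the parameters of [theta]. *)
  destruct (@params_in_chain L M (fun N x => A (idx x) 2 = x /\ idx x < N)) with (phi := theta)
    as [N HN].
  { intros k k' x le [E lt]. split; [exact E | lia]. }
  { revert H2. apply params_in_mono. intros x Hx. exists (S (idx x)).
    split; [apply Hidx, Hx | lia]. }
  exists N.
  set (chi := fsub (fun _ => inl 0) (fun x => inl (S (idx x))) theta : mformula M).
  assert (pf : parameter_free chi).
  { destruct (@params_in_chain L M (fun m x => S (idx x) < m)) with (phi := theta) as [m Hm].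
    { intros k k' x le lt. lia. }
    { apply params_in_mono with (A := fun _ => True); [| apply params_in_full].
      intros x _. exists (S (S (idx x))). lia. }
    apply (@fsub_ok L M M (fun x => S (idx x) < m) (fun _ => False) theta 1 (S m)) with (3 := H1);
      [intros n _; cbn; lia | intros x lt; cbn; lia | exact Hm]. }
  set (g := fun v => match v with 0 => N | S k => k end).
  set (h := fun v => match v with 0 => 0 | S _ => 1 end).
  assert (E : forall i j, N <= i -> j < 2 ->
            sat (env1 (A i j)) theta <-> sat (fun v => A (g v) (h v)) chi).
  { intros i j le lt.
    (* The model configuration has the entry at [(N, 0)] and the parameters in column 1. [rho] fixes
       the rows below [N] and sends [N] to [i]; [tau] sends 0 to [j] and 1 to 2, and is increasing
       because [j < 2]. *)
    set (rho := fun k => if k <? N then k else k + (i - N)).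
    set (tau := fun k => match k with 0 => j | S k => S (S k) end).
    rewrite <- (ind chi g h rho tau pf).
    - unfold chi. rewrite sat_sub. rewrite <- (gsat_id theta).
      apply gsat_ext with (A := fun x => A (idx x) 2 = x /\ idx x < N) (k := 1); auto.
      + intros x [Ex lx]. cbn. unfold rho. destruct (Nat.ltb_spec (idx x) N); [symmetry; exact Ex | lia].
      + intros n _. cbn. unfold rho. rewrite Nat.ltb_irrefl. unfold env1. f_equal. lia.
    - intros k k' lk. unfold rho. destruct (Nat.ltb_spec k N), (Nat.ltb_spec k' N); lia.
    - intros [| k] [| k'] lk; cbn; lia. }
  intros i i' j j' Hi Hi' Hj Hj'. rewrite (E i j Hi Hj), (E i' j' Hi' Hj'). auto.
Qed.

(** Near the left end of the limit type over column 2, entries of column 0 approximate points where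
    [psi] with parameters [c] holds and entries of column 1 points where it fails, contradicting
    [decided_below]. *)
Lemma no_row_increasing_array (A : nat -> nat -> M) (delta : mformula M) (lt : M -> M -> Prop)
  (psi : mformula M) (c : nat -> M) :
  indiscernible_array M A -> parameter_free psi -> fbound 1 delta -> parameter_free delta -> free_order delta lt ->
  (forall i j, sat (env1 (A i j)) delta) -> row_increasing A lt ->
  (forall r s, sat (scons (A r s) c) psi <-> s = 0) -> False.
Proof.
  intros ind pf_psi Hd pfd [lin [inv [def_l def_r]]] AD incr Hpsi.
  set (B := fun x => exists k, A k 2 = x).
  assert (small_B : small M K B) by (apply (small_range mon (fun k => A k 2))).
  set (p := fun theta : mformula M => (fbound 1 theta /\ params_in B theta) /\
                   exists n, forall i, n <= i -> sat (env1 (A i 0)) theta).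
  assert (p_any : forall theta, p theta -> exists n, forall i j, n <= i -> j < 2 -> sat (env1 (A i j)) theta).
  { intros theta [[H1 H2] [n Hn]]. destruct (eventual_truth theta ind H1 H2) as [N HN].
    exists (max n N). intros i j le lt2. apply (HN i i 0 j); try lia. apply Hn. lia. }
  assert (p_fin : forall l, (forall theta, In theta l -> p theta) ->
     exists n, forall i j, n <= i -> j < 2 -> forall theta, In theta l -> sat (env1 (A i j)) theta).
  { induction l as [| theta l IH]; intros Hl.
    - exists 0. intros i j _ _ theta [].
    - destruct IH as [n Hn]; [intros eta He; apply Hl; right; exact He |].
      destruct (p_any theta (Hl theta (or_introl eq_refl))) as [n' Hn'].
      exists (max n n'). intros i j le lt2 eta [<- | He]; [apply Hn' | apply Hn]; auto; lia. }
  assert (cp : complete_1type B p).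
  { split; [| split].
    - intros theta [H _]. exact H.
    - intros l Hl. destruct (p_fin l Hl) as [n Hn]. exists (A n 0). apply Hn; lia.
    - intros theta H1 H2. destruct (eventual_truth theta ind H1 H2) as [N HN].
      destruct (classic (sat (env1 (A N 0)) theta)) as [H | H]; [left | right];
        (split; [split; assumption |]); exists N; intros i le.
      + apply (HN N i 0 0); auto.
      + intros H'. apply H. apply (HN i N 0 0); auto. }
  assert (pD : forall x, realizes p x -> sat (env1 x) delta).
  { intros x px. apply px. split; [split; [exact Hd |] | exists 0; auto].
    revert pfd. apply params_in_mono. tauto. }
  assert (lin_p : linear_on M (realizes p) lt).
  { destruct lin as [irr [tr tot]]. split; [| split]; eauto 6. }
  assert (inv_p : invariant_over M B lt).
  { intros s aut _. apply inv; [exact aut | tauto]. }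
  (* The limit type contains the formula placing its realizations above the entry of column 2 in row
     [S i], which exceeds [A i j]. *)
  assert (above : forall z i j, realizes p z -> lt (A i j) z).
  { intros z i j pz. destruct lin as [_ [tr _]].
    apply (tr (A i j) (A (S i) 2) z); auto.
    destruct (def_r (A (S i) 2)) as [eta [H1 [H2 E]]]. apply E, pz.
    split; [split; [exact H1 |] | exists (S (S i)); intros i' le; apply E, incr; lia].
    revert H2. apply params_in_mono. intros x ->. exists (S i). reflexivity. }
  set (v := fun n => match n with 0 => inl 0 | S u => inr (c u) end : nat + M).
  set (chi := fsub v (fun x => inr x) psi : mformula M).
  destruct (fbound_exists psi) as [k Hk].
  destruct (@fsub_ok L M M (fun _ => False) (fun x => exists u, c u = x) psi k 1 v (fun x => inr x))
    as [H1 H2]; auto.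
  { intros [| n] _; cbn; [lia | eauto]. }
  { intros q []. }
  fold chi in H1, H2.
  assert (Echi : forall x, sat (env1 x) chi <-> sat (scons x c) psi).
  { intros x. unfold chi. rewrite sat_sub_vars. apply sat_eq_env. intros [| n]; reflexivity. }
  destruct (decided_below mon small_B cp (all_so small_B cp) chi lin_p inv_p) as [z [pz Hz]];
    [| exact H1 |].
  { intros w _. destruct (def_l w) as [eta [E1 [_ E3]]]. eauto. }
  destruct mon as [_ [_ [saturation _]]].
  (* Every entry lies below [z], so far entries of column [j] satisfy any finite part of [p]
     together with [x < z] and [chi']; saturation then gives a realization of [p] with both
     properties. *)
  assert (coinitial : forall chi' j, fbound 1 chi' -> params_in (fun x => exists u, c u = x) chi' ->
     j < 2 -> (forall i, sat (env1 (A i j)) chi') ->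
     exists x, realizes p x /\ lt x z /\ sat (env1 x) chi').
  { intros chi' j E1 E2 lt2 Hchi'. destruct (def_l z) as [eta [F1 [F2 F3]]].
    destruct (saturation (fun x => (B x \/ exists u, c u = x) \/ x = z)
       (fun theta => p theta \/ theta = eta \/ theta = chi')) as [x Hx].
    - apply (small_add mon), (small_union mon); [exact small_B | apply (small_range mon)].
    - intros theta [[[H3 H4] _] | [-> | ->]]; (split; [assumption |]).
      + revert H4. apply params_in_mono. auto.
      + revert F2. apply params_in_mono. auto.
      + revert E2. apply params_in_mono. auto.
    - intros l Hl.
      assert (fin : exists n, forall i, n <= i -> forall theta, In theta l -> sat (env1 (A i j)) theta).
      { induction l as [| theta l IH].
        - exists 0. intros i _ theta [].
        - destruct IH as [n Hn]; [intros theta' Ht; apply Hl; right; exact Ht |].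
          assert (one : exists n', forall i, n' <= i -> sat (env1 (A i j)) theta).
          { destruct (Hl theta (or_introl eq_refl)) as [Hp | [-> | ->]].
            - destruct (p_any theta Hp) as [n' Hn']. exists n'. auto.
            - exists 0. intros i _. apply F3, above, pz.
            - exists 0. auto. }
          destruct one as [n' Hn']. exists (max n n').
          intros i le theta' [<- | Ht]; [apply Hn' | apply Hn]; auto; lia. }
      destruct fin as [n Hn]. exists (A n j). exact (Hn n (le_n n)).
    - exists x. split; [intros theta Ht; apply Hx; auto |].
      split; [apply F3, Hx; auto | apply Hx; auto]. }
  destruct Hz as [Hz | Hz].
  - destruct (coinitial (fneg chi) 1) as [x [px [lx Hx]]]; auto.
    + intros i. cbn. rewrite Echi, Hpsi. lia.
    + exact (Hx (Hz x px lx)).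
  - destruct (coinitial chi 0) as [x [px [lx Hx]]]; auto.
    + intros i. rewrite Echi, Hpsi. reflexivity.
    + exact (Hz x px lx Hx).
Qed.

(* The order of two array entries depends only on the relative position of their
   rows and columns; with the entries in rows 0, 1 and columns 0, 1 as test cases,
   this leaves only the lexicographic orders and their reverses. *)
Lemma lexicographic_array (A : nat -> nat -> M) (lt : M -> M -> Prop) :
  (forall i j i' j' rho tau, increasing rho -> increasing tau ->
     lt (A (rho i) (tau j)) (A (rho i') (tau j')) <-> lt (A i j) (A i' j')) ->
  (forall i j k i' j' k', lt (A i j) (A i' j') -> lt (A i' j') (A k k') -> lt (A i j) (A k k')) ->
  (lt (A 0 0) (A 0 1) \/ lt (A 0 1) (A 0 0)) ->
  (lt (A 0 1) (A 1 0) \/ lt (A 1 0) (A 0 1)) ->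
  (lt (A 0 0) (A 1 1) \/ lt (A 1 1) (A 0 0)) ->
  lt (A 0 0) (A 1 0) ->
  row_increasing A lt \/ row_increasing (fun r s => A s r) lt \/
  row_increasing (fun r s => A s r) (flip M lt).
Proof.
  intros inv tr t1 t2 t3 l10.
  (* The increasing map with values [i] at 0 and [i'] at 1 carries the test cases to arbitrary pairs
     of rows or columns. *)
  set (jump := fun i i' k : nat => match k with 0 => i | S k => i' + k end).
  assert (J : forall i i', i < i' -> increasing (jump i i')).
  { intros i i' l [| k] [| k'] lk; cbn; lia. }
  assert (C : forall i i' j j' r s r' s', i < i' -> j < j' -> lt (A r s) (A r' s') ->
    lt (A (jump i i' r) (jump j j' s)) (A (jump i i' r') (jump j j' s'))).
  { intros i i' j j' r s r' s' li lj. apply inv; apply J; assumption. }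
  assert (z : forall i i', jump i i' 1 = i') by (intros; cbn; lia).
  assert (up : forall i i' j, i < i' -> lt (A i j) (A i' j)).
  { intros i i' j li. specialize (C i i' j (S j) 0 0 1 0 li ltac:(lia) l10). rewrite z in C. exact C. }
  destruct t1 as [l01 | l01].
  - assert (right : forall i j j', j < j' -> lt (A i j) (A i j')).
    { intros i j j' lj. specialize (C i (S i) j j' 0 0 0 1 ltac:(lia) lj l01). rewrite z in C. exact C. }
    destruct t2 as [l | l].
    + left. intros i i' j j' li. destruct (Nat.lt_trichotomy j j') as [lj | [<- | lj]].
      * apply (tr i j _ i j'); auto.
      * auto.
      * specialize (C i i' j' j 0 1 1 0 li lj l). rewrite !z in C. exact C.
    + right. left. intros j j' i i' lj. destruct (Nat.lt_trichotomy i i') as [li | [<- | li]].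
      * apply (tr i j _ i j'); auto.
      * auto.
      * specialize (C i' i j j' 1 0 0 1 li lj l). rewrite !z in C. exact C.
  - assert (left' : forall i j j', j < j' -> lt (A i j') (A i j)).
    { intros i j j' lj. specialize (C i (S i) j j' 0 1 0 0 ltac:(lia) lj l01). rewrite z in C. exact C. }
    destruct t3 as [l | l].
    + left. intros i i' j j' li. destruct (Nat.lt_trichotomy j j') as [lj | [<- | lj]].
      * specialize (C i i' j j' 0 0 1 1 li lj l). rewrite !z in C. exact C.
      * auto.
      * apply (tr i j _ i j'); auto.
    + right. right. intros j j' i i' lj. unfold flip. destruct (Nat.lt_trichotomy i i') as [li | [<- | li]].
      * specialize (C i i' j j' 1 1 0 0 li lj l). rewrite !z in C. exact C.
      * auto.
      * apply (tr i' j' _ i j'); auto.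
Qed.

Lemma stationarily_ordered_dp_minimal : dp_minimal M.
Proof.
  intros [phi [psi [b [c [pf_phi [pf_psi pattern]]]]]].
  set (a := fun i j => proj1_sig (constructive_indefinite_description _ (pattern i j))).
  assert (Ha : forall i j, sat (scons (a i j) (b i)) phi /\ sat (scons (a i j) (c j)) psi /\
        (forall k, k <> i -> ~ sat (scons (a i j) (b k)) phi) /\
        (forall k, k <> j -> ~ sat (scons (a i j) (c k)) psi)).
  { intros i j. unfold a. destruct constructive_indefinite_description as [x Hx]. exact Hx. }
  destruct (@indiscernible_extraction L M K mon a b c phi psi pf_phi pf_psi)
    as [A [b' [c' [ind [Hb Hc]]]]].
  { intros i k j. destruct (Ha i j) as [H1 [_ [H2 _]]]. split; [| intros ->; exact H1].
    intros H. destruct (Nat.eq_dec k i) as [e | ne]; [exact e | destruct (H2 k ne H)]. }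
  { intros i j k. destruct (Ha i j) as [_ [H1 [_ H2]]]. split; [| intros ->; exact H1].
    intros H. destruct (Nat.eq_dec k j) as [e | ne]; [exact e | destruct (H2 k ne H)]. }
  destruct (free_order_exists (A 0 0)) as [delta [lambda [Hd [pfd [d00 [Hl [pfl ord]]]]]]].
  assert (AD : forall i j, sat (env1 (A i j)) delta).
  { intros i j. apply (ind delta (fun _ => 0) (fun _ => 0) (fun k => i + k) (fun k => j + k)) in d00;
      [| exact pfd | intros k k' l; lia | intros k k' l; lia].
    revert d00. apply sat_eq_env. intros n. unfold env1. f_equal; lia. }
  assert (inv : forall i j i' j' rho tau, increasing rho -> increasing tau ->
     sat (scons (A (rho i) (tau j)) (env1 (A (rho i') (tau j')))) lambda <->
     sat (scons (A i j) (env1 (A i' j'))) lambda).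
  { intros i j i' j' rho tau Hr Ht.
    rewrite (sat_eq_env lambda _ (fun v => A (rho (scons i (env1 i') v)) (tau (scons j (env1 j') v)))).
    - rewrite (ind lambda (scons i (env1 i')) (scons j (env1 j')) rho tau pfl Hr Ht).
      apply sat_eq_env. intros [| n]; reflexivity.
    - intros [| n]; reflexivity. }
  (* The sets cutting out row 0 and column 0 separate entries that differ in whether an index is 0.
     This suffices for all test cases. *)
  assert (distinct : forall i j i' j', A i j = A i' j' -> (i = 0 <-> i' = 0) /\ (j = 0 <-> j' = 0)).
  { intros i j i' j' E. rewrite <- (Hb i j), <- (Hb i' j'), <- (Hc i j), <- (Hc i' j'), E. tauto. }
  set (lt := fun x y => sat (scons x (env1 y)) lambda) in *.
  assert (total : forall i j i' j', ~ ((i = 0 <-> i' = 0) /\ (j = 0 <-> j' = 0)) ->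
            lt (A i j) (A i' j') \/ lt (A i' j') (A i j)).
  { intros i j i' j' ne. destruct ord as [[_ [_ tot]] _]. apply tot; auto. }
  assert (trans : forall i j k i' j' k', lt (A i j) (A i' j') -> lt (A i' j') (A k k') -> lt (A i j) (A k k')).
  { intros i j k i' j' k'. destruct ord as [[_ [tr _]] _]. apply tr; auto. }
  assert (rows : forall R, free_order delta R -> row_increasing A R -> False).
  { intros R HR incr. exact (no_row_increasing_array psi c' ind pf_psi Hd pfd HR AD incr Hc). }
  assert (cols : forall R, free_order delta R -> row_increasing (fun r s => A s r) R -> False).
  { intros R HR incr.
    apply (no_row_increasing_array phi b' (indiscernible_array_transpose ind) pf_phi Hd pfd HR); auto. }
  assert (ord' := free_order_flip ord).
  (* Reversing the order if necessary makes column 0 increasing, as [lexicographic_array]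
     requires. *)
  destruct (total 0 0 1 0 ltac:(lia)) as [l | l].
  - destruct (@lexicographic_array A lt inv trans) as [H | [H | H]]; eauto;
      apply total; lia.
  - destruct (@lexicographic_array A (flip M lt)) as [H | [H | H]];
      auto; unfold flip; eauto; apply total; lia.
Qed.
End DpMinimality.

Unset Implicit Arguments.

Theorem theorem5 (L : language) (M : structure L) (K : Type) :
  monster M K ->
  (forall (A : M -> Prop) (p : mformula M -> Prop),
      small M K A -> complete_1type A p -> stationarily_ordered A p) ->
  dp_minimal M /\
  (forall (A : M -> Prop) (n : nat) (a b : nat -> M),
      small M K A -> same_type M A n a b -> same_lstp M K A n a b).
Proof.
  intros mon all_so. split.
  - exact (stationarily_ordered_dp_minimal mon all_so).
  - intros A n a b HA. exact (same_type_same_lstp mon all_so HA).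
Qed.
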